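(* The quantitative equality problem is undecidable for probabilistic automata with safety acceptance conditions, and also for acceptance-absorbing probabilistic automata with reachability acceptance conditions. That is, there is no algorithm that, given a probabilistic automaton $\mathcal{A}$ with a set $F$ of accepting states and a rational $0<\lambda<1$, decides whether there exists an infinite word $w$ with $\mathbb{P}^w_{\mathcal{A}}(\Phi)=\lambda$, where $\Phi=\mathrm{Safe}(F)$; and likewise when $\mathcal{A}$ is restricted to be acceptance-absorbing and $\Phi=\mathrm{Reach}(F)$.
   Context: A probabilistic automaton $\mathcal{A}=(Q,q_\iota,\Sigma,\mathcal{M})$ has finite state set $Q$, initial state $q_\iota$, finite alphabet $\Sigma$, and a stochastic matrix $M_\sigma$ on $Q\times Q$ for each $\sigma\in\Sigma$. For an infinite word $w=w_1w_2\cdots$, $\mathbb{P}^w_{\mathcal{A}}$ is the probability measure on infinite state sequences (paths) $(q_0,q_1,\dots)$ determined by: the set of paths with prefix $(p_0,\dots,p_n)$ has probability $[p_0=q_\iota]\prod_{j=1}^nM_{w_j}(p_{j-1},p_j)$. For $F\subseteq Q$: $\mathrm{Safe}(F)$ is the set of paths with all states in $F$; $\mathrm{Reach}(F)$ is the set of paths visiting $F$ at least once. A state $q$ is absorbing if $M_\sigma(q,q)=1$ for all $\sigma$; $\mathcal{A}$ is acceptance-absorbing if every state in $F$ is absorbing. *)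

(* Defs.v *)
(* MathComp / MathComp-Analysis *)
From HB Require Import structures.
From mathcomp Require Import all_boot all_order all_algebra.
From mathcomp Require Import all_classical all_reals all_analysis.

Set Implicit Arguments.
Unset Strict Implicit.
Unset Printing Implicit Defensive.

Import Order.TTheory GRing.Theory Num.Theory.
Import numFieldNormedType.Exports.

Local Open Scope classical_set_scope.
Local Open Scope ring_scope.

(* Transition probabilities are rational, so that an automaton is a finite    *)
(* object which can be given as an input to an algorithm.                     *)
Record pautomaton (Q S : finType) := PAutomaton {
  init : Q ;
  trans : S -> Q -> Q -> rat ;
  trans_ge0 : forall a p q, 0 <= trans a p q ;
  trans_sum1 : forall a p, \sum_q trans a p q = 1 }.

Definition absorbing (Q S : finType) (A : pautomaton Q S) (q : Q) : Prop :=
  forall a, trans A a q q = 1.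

Definition acceptance_absorbing (Q S : finType) (A : pautomaton Q S)
  (F : {set Q}) : Prop := forall q, q \in F -> absorbing A q.

(* The type of paths depends on A only to make it pointed, as is required by  *)
(* g_sigma_algebraType.                                                       *)
Definition path_of (Q S : finType) (A : pautomaton Q S) : Type := nat -> Q.

HB.instance Definition _ (Q S : finType) (A : pautomaton Q S) :=
  Choice.copy (path_of A) (nat -> Q).
HB.instance Definition _ (Q S : finType) (A : pautomaton Q S) :=
  isPointed.Build (path_of A) (fun=> init A).

(* The cylinder of the finite prefix (p 0, ..., p n). *)
Definition cylinder (Q S : finType) (A : pautomaton Q S) (p : nat -> Q)
  (n : nat) : set (path_of A) := [set x | forall i, (i <= n)%N -> x i = p i].
Arguments cylinder {Q S} A p n.

Definition cylinders (Q S : finType) (A : pautomaton Q S) :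
  set (set (path_of A)) := [set C | exists p n, C = cylinder A p n].
Arguments cylinders {Q S} A.

Definition path_space (Q S : finType) (A : pautomaton Q S) :=
  g_sigma_algebraType (cylinders A).

(* w j is the (j+1)-st letter of the word. *)
Definition prefix_weight (Q S : finType) (A : pautomaton Q S) (w : nat -> S)
  (p : nat -> Q) (n : nat) : rat :=
  (p 0%N == init A)%:R * \prod_(j < n) trans A (w j) (p j) (p j.+1).

Definition is_path_prob (R : realType) (Q S : finType) (A : pautomaton Q S)
  (w : nat -> S) (P : probability (path_space A) R) : Prop :=
  forall p n, P (cylinder A p n) = (ratr (prefix_weight A w p n))%:E.

Definition safe (Q S : finType) (A : pautomaton Q S) (F : {set Q}) :
  set (path_space A) := [set x | forall i, x i \in F].
Arguments safe {Q S} A F.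

Definition reach (Q S : finType) (A : pautomaton Q S) (F : {set Q}) :
  set (path_space A) := [set x | exists i, x i \in F].
Arguments reach {Q S} A F.

Section measurability_of_events.
Variables (Q S : finType) (A : pautomaton Q S).

Lemma measurable_cylinder (p : nat -> Q) n :
  measurable (cylinder A p n : set (path_space A)).
Proof. by apply: sub_sigma_algebra; exists p, n. Qed.

Lemma measurable_coord i q : measurable ([set x | x i = q] : set (path_space A)).
Proof.
have -> : ([set x | x i = q] : set (path_space A)) =
   \bigcup_(t in [set t : {ffun 'I_i.+1 -> Q} | t ord_max = q])
     (cylinder A (fun j => t (inord j)) i : set (path_space A)).
  apply/seteqP; split => x /=.
    move=> xi; exists [ffun j : 'I_i.+1 => x j]; first by rewrite /= ffunE.
    by move=> j ji; rewrite ffunE inordK.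
  case=> t /= ti /(_ i (leqnn _)) ->; rewrite -ti; congr (t _).
  by apply/val_inj; rewrite /= inordK.
apply: fin_bigcup_measurable; first exact: finite_finset.
by move=> t _; exact: measurable_cylinder.
Qed.

Lemma measurable_coord_in i (F : {set Q}) :
  measurable ([set x | x i \in F] : set (path_space A)).
Proof.
have -> : ([set x | x i \in F] : set (path_space A)) =
   \bigcup_(q in [set` F]) ([set x | x i = q] : set (path_space A)).
  apply/seteqP; split => x /=; first by move=> xF; exists (x i).
  by case=> q /= qF ->.
apply: fin_bigcup_measurable; first exact: finite_finset.
by move=> t _; exact: measurable_coord.
Qed.

Lemma measurable_safe (F : {set Q}) : measurable (safe A F).
Proof.
have -> : safe A F = \bigcap_i ([set x | x i \in F] : set (path_space A)).
  by apply/seteqP; split => x /= xF i *; exact: xF.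
by apply: bigcapT_measurable => i; exact: measurable_coord_in.
Qed.

Lemma measurable_reach (F : {set Q}) : measurable (reach A F).
Proof.
have -> : reach A F = \bigcup_i ([set x | x i \in F] : set (path_space A)).
  apply/seteqP; split => x /=; first by case=> i xi; exists i.
  by case=> i _ xi; exists i.
by apply: bigcupT_measurable => i; exact: measurable_coord_in.
Qed.

End measurability_of_events.

Section path_prob_unique.
Variables (R : realType) (Q S : finType) (A : pautomaton Q S) (w : nat -> S).

Lemma path_prob_unique (P1 P2 : probability (path_space A) R) :
  is_path_prob w P1 -> is_path_prob w P2 ->
  forall E, measurable E -> P1 E = P2 E.
Proof.
move=> h1 h2 E mE.
pose G : set (set (path_space A)) := cylinders A `|` [set set0; setT].
have GS : (measurable : set (set (path_space A))) = <<s G >>.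
  apply/seteqP; split.
    apply: smallest_sub; first exact: smallest_sigma_algebra.
    by move=> C hC; apply: sub_sigma_algebra; left.
  apply: smallest_sub; first exact: sigma_algebra_measurable.
  move=> C [[p [n ->]]|[->|->]]; [exact: measurable_cylinder| |] => //.
apply: (measure_unique G (fun=> setT)) => //.
- move=> X Y [[p [n ->]]|[->|->]] [[p' [n' ->]]|[->|->]]; last first.
  all: rewrite ?setI0 ?set0I ?setIT ?setTI.
  all: try by right; left.
  all: try by right; right.
  all: try by left; exists p, n.
  all: try by left; exists p', n'.
  have [[x hx]|] := pselect (exists x, (cylinder A p n `&` cylinder A p' n') x).
    left; exists x, (maxn n n'); apply/seteqP; split => y /=.
      case: hx => xp xp' [yp yp'] i; rewrite leq_max => /orP[] h.
        by rewrite yp// xp.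
      by rewrite yp'// xp'.
    move=> yx; case: hx => xp xp'; split => i h.
      by rewrite yx ?xp// leq_max h.
    by rewrite yx ?xp'// leq_max h orbT.
  move=> hn; right; left; apply/seteqP; split => // x hx.
  by apply: hn; exists x.
- by apply/seteqP; split => // x _; exists 0%N.
- move=> X [[p [n ->]]|[->|->]]; first exact: (eq_trans (h1 p n) (esym (h2 p n))).
    by rewrite !measure0.
  exact: (eq_trans (probability_setT P1) (esym (probability_setT P2))).
- by move=> _; apply: (eq_ind_r (fun z => (z < +oo)%E) _ (probability_setT P1)); exact: ltry.
Qed.

End path_prob_unique.

(* Existence: the law of a path driven by one uniform variable u in [0, 1[.   *)
(* At each step [0, 1[ is cut into consecutive intervals whose lengths are    *)
(* the transition probabilities; the interval containing the current residual *)
(* selects the next state, and its rescaled position is the new residual.     *)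
Section path_prob_exists.
Variables (R : realType) (Q S : finType) (A : pautomaton Q S) (w : nat -> S).

Let T (a : S) (p q : Q) : R := ratr (trans A a p q).

Let T_ge0 a p q : 0 <= T a p q.
Proof. by rewrite /T ler0q; exact: trans_ge0. Qed.

Let T_sum1 a p : \sum_q T a p q = 1.
Proof. by rewrite /T -rmorph_sum trans_sum1 rmorph1. Qed.

Let C a p (i : nat) : R := \sum_(x | (enum_rank x < i)%N) T a p x.

Let C_ge0 a p i : 0 <= C a p i.
Proof. by apply: sumr_ge0. Qed.

Let C_mono a p i j : (i <= j)%N -> C a p i <= C a p j.
Proof.
move=> ij; rewrite /C [leRHS](bigID (fun x => (enum_rank x < i)%N)) /=.
rewrite -[leLHS]addr0; apply: lerD; last exact: sumr_ge0.
rewrite le_eqVlt; apply/orP; left; apply/eqP; apply: eq_bigl => x.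
by apply/idP/andP => [h|[]//]; split => //; exact: leq_trans ij.
Qed.

Let CS a p q : C a p (enum_rank q).+1 = C a p (enum_rank q) + T a p q.
Proof.
rewrite /C (bigD1 q) //= addrC; congr (_ + _); apply: eq_bigl => x.
rewrite ltnS ltn_neqAle andbC; congr (_ && _).
by rewrite (inj_eq val_inj) (inj_eq enum_rank_inj).
Qed.

Let C_all a p : C a p #|Q| = 1.
Proof. by rewrite -(T_sum1 a p); apply: eq_bigl => x; rewrite ltn_ord. Qed.

Let sel a p (r : R) (q : Q) :=
  (C a p (enum_rank q) <= r) && (r < C a p (enum_rank q).+1).

Let next a p (r : R) : Q := odflt p [pick q | sel a p r q].

Let sel_inj a p r q q' : sel a p r q -> sel a p r q' -> q = q'.
Proof.
wlog: q q' / (enum_rank q <= enum_rank q')%N => [hw|].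
  by case/orP: (leq_total (enum_rank q) (enum_rank q')) => h h1 h2;
    [apply: hw|apply/esym/hw].
rewrite leq_eqVlt => /orP[/eqP/val_inj/enum_rank_inj//|h].
move=> /andP[_ h1] /andP[h2 _]; have := lt_le_trans h1 (C_mono a p h).
by rewrite ltNge h2.
Qed.

Let nextP a p r q : 0 <= r < 1 -> (next a p r = q) <-> sel a p r q.
Proof.
move=> /andP[r0 r1]; rewrite /next; case: pickP => [q' hq'|hn] /=.
  split => [<-//|]; exact: sel_inj.
have ex : exists i, r < C a p i by exists #|Q|; rewrite C_all.
case: (ex_minnP ex) => -[|j]; first by rewrite /C big_pred0// ltNge r0.
move=> rj min; have jQ : (j < #|Q|)%N.
  by apply: min; rewrite C_all.
have := hn (enum_val (Ordinal jQ)); rewrite /sel enum_valK /= rj andbT leNgt.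
by move/negbFE/min; rewrite ltnn.
Qed.

Let step a (x : Q * R) : Q * R :=
  let q := next a x.1 x.2 in
  (q, (x.2 - C a x.1 (enum_rank q)) / T a x.1 q).

Let run (u : R) := fix run n : Q * R :=
  if n is m.+1 then step (w m) (run m) else (init A, u).

Let run_itv u n : 0 <= u < 1 -> 0 <= (run u n).2 < 1.
Proof.
move=> hu; elim: n => [//|n /=]; case: (run u n) => p r /= hr.
have /(nextP _ _ _ hr) : next (w n) p r = next (w n) p r by [].
set q := next _ _ _ => /andP[h1]; rewrite CS => h2.
have T0 : 0 < T (w n) p q by have := le_lt_trans h1 h2; rewrite ltrDl.
by rewrite divr_ge0 ?subr_ge0 ?(ltW T0)//= ltr_pdivrMr// mul1r ltrBlDl.
Qed.

Let W (p : nat -> Q) n : R := ratr (prefix_weight A w p n).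

Let W_ge0 p n : 0 <= W p n.
Proof.
rewrite /W ler0q /prefix_weight mulr_ge0 ?ler0n//.
by apply: prodr_ge0 => i _; exact: trans_ge0.
Qed.

Let W_S p n : W p n.+1 = W p n * T (w n) (p n) (p n.+1).
Proof. by rewrite /W /T /prefix_weight big_ord_recr /= mulrA rmorphM. Qed.

Let traj (u : R) : path_space A := fun n => (run u n).1.

Let itv_nil (u a : R) : (u \in `[a, a[) = false.
Proof. by rewrite in_itv/=; apply/negP => /andP[/le_lt_trans h/h]; rewrite ltxx. Qed.

Let traj_cyl (p : nat -> Q) n : exists a : R,
  (`[0, 1[ `&` traj @^-1` (cylinder A p n) = `[a, a + W p n[%classic) /\
  (forall u, u \in `[a, a + W p n[ -> (run u n).2 = (u - a) / W p n).
Proof.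
elim: n => [|n [a [IH1 IH2]]].
  exists 0; rewrite /W /prefix_weight big_ord0 mulr1 rmorph_nat add0r.
  have [p0|p0] := eqVneq (p 0%N) (init A); split.
  - apply/seteqP; split => u /=; first by case.
    by move=> hu; split => // i; rewrite leqn0 => /eqP ->; rewrite /traj/= p0.
  - by move=> u _; rewrite /= subr0 divr1.
  - apply/seteqP; split => u /=; last by rewrite ?addr0 itv_nil.
    by case=> _ /(_ 0%N isT) h; move: p0; rewrite -h eqxx.
  - by move=> u; rewrite in_itv/= => /andP[/le_lt_trans h/h]; rewrite ltxx.
have IH1' u : (u \in `[0, 1[) /\ (forall i, (i <= n)%N -> traj u i = p i) <->
    u \in `[a, a + W p n[.
  have : (`[0, 1[ `&` traj @^-1` (cylinder A p n)) u <-> `[a, a + W p n[%classic u by rewrite IH1.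
  by [].
set m := W p n in IH1 IH2 IH1' *; set t := T (w n) (p n) (p n.+1).
set c := C (w n) (p n) (enum_rank (p n.+1)).
have cS : C (w n) (p n) (enum_rank (p n.+1)).+1 = c + t by rewrite CS.
have ct1 : c + t <= 1 by rewrite -cS -(C_all (w n) (p n)) C_mono.
have c0 : 0 <= c by exact: C_ge0.
have t0 : 0 <= t by exact: T_ge0.
have key u : (u \in `[0, 1[) /\ (forall i, (i <= n.+1)%N -> traj u i = p i) <->
    u \in `[a + m * c, a + m * c + m * t[.
  have [m0|m0] := eqVneq m 0.
    rewrite m0 !mul0r !addr0; split; last first.
      by rewrite itv_nil.
    case=> u01 hu; have /IH1' : (u \in `[0, 1[) /\ (forall i, (i <= n)%N -> traj u i = p i).
      by split => // i /leqW; exact: hu.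
    by rewrite m0 addr0 itv_nil.
  have mp : 0 < m by rewrite lt_neqAle eq_sym m0 W_ge0.
  have E : u \in `[a, a + m[ ->
      ((u \in `[a + m * c, a + m * c + m * t[) = sel (w n) (p n) ((u - a) / m) (p n.+1)).
    move=> _; rewrite /sel cS in_itv/= ler_pdivlMr// ltr_pdivrMr//.
    by rewrite lerBrDl ltrBlDl [c * m]mulrC [(c + t) * m]mulrC mulrDr addrA.
  split.
    case=> u01 hu; have hm : u \in `[a, a + m[.
      by apply/IH1'; split => // i /leqW; exact: hu.
    rewrite E//; apply/nextP; first by rewrite -IH2//; exact: run_itv.
    rewrite -IH2// -(hu n.+1 (leqnn _)) -(hu n (leqnSn _)).
    by [].
  move=> hu; have hm : u \in `[a, a + m[.
    move: hu; rewrite !in_itv/= => /andP[h1 h2]; apply/andP; split.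
      by apply: le_trans h1; rewrite lerDl mulr_ge0// ltW.
    apply: lt_le_trans h2 _; rewrite -addrA lerD2l -mulrDr.
    by rewrite -[leRHS]mulr1 ler_pM2l.
  have /IH1'[u01 hn] := hm; split => // i.
  rewrite leq_eqVlt => /orP[/eqP ->|]; last by rewrite ltnS; exact: hn.
  move: hu; rewrite E// => /nextP; rewrite -IH2// => /(_ (run_itv n u01)).
  by rewrite -(hn n (leqnn _)).
exists (a + m * c); rewrite W_S -/m -/t; split.
  by apply/seteqP; split => u /key.
move=> u hu; have /key[u01 hn] := hu.
have hm : u \in `[a, a + m[.
  by apply/IH1'; split => // i /leqW; exact: hn.
have pn : (run u n).1 = p n by exact: hn.
have pn1 : next (w n) (p n) ((run u n).2) = p n.+1.
  by rewrite -(hn n.+1 (leqnn _)) -pn.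
rewrite /= /step pn pn1 -/c -/t IH2//.
have [m0|m0] := eqVneq m 0; first by move: hm; rewrite m0 addr0 itv_nil.
rewrite [(m * t)^-1]invfM [RHS]mulrA; congr (_ / _).
by rewrite opprD addrA [RHS]mulrBl [m * c]mulrC mulfK.
Qed.

Let D : set R := `[0, 1[%classic.
Let mD : measurable D. Proof. exact: measurable_itv. Qed.

Let traj_meas (E : set (path_space A)) : measurable E ->
  measurable (D `&` traj @^-1` E).
Proof.
move=> mE; have h : measurable_fun D traj.
  apply: (@measurability _ _ _ (path_space A) D traj (cylinders A)); first by [].
  move=> _ [_ [p [n ->]] <-]; have [a [-> _]] := traj_cyl p n.
  exact: measurable_itv.
exact: h.
Qed.

Let law (E : set (path_space A)) : \bar R :=
  lebesgue_measure (D `&` traj @^-1` E).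

Let law0 : law set0 = 0%E.
Proof. by rewrite /law preimage_set0 setI0 measure0. Qed.

Let law_ge0 E : (0 <= law E)%E. Proof. exact: measure_ge0. Qed.

Let law_sigma_additive : semi_sigma_additive law.
Proof.
move=> F mF tF mUF; rewrite /law preimage_bigcup setI_bigcupr.
apply: measure_semi_sigma_additive.
- by move=> n; exact: traj_meas.
- apply/trivIsetP => i j _ _ ij; rewrite setIACA setIid -preimage_setI.
  by move/trivIsetP : tF => ->//; rewrite preimage_set0 setI0.
- by rewrite -setI_bigcupr -preimage_bigcup; exact: traj_meas.
Qed.

HB.instance Definition _ := isMeasure.Build _ _ _ law
  law0 law_ge0 law_sigma_additive.

Let law_setT : law setT = 1%:E.
Proof.
by rewrite /law preimage_setT setIT lebesgue_measure_itv/= lte_fin ltr01 sube0.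
Qed.

HB.instance Definition _ := Measure_isProbability.Build _ _ _ law law_setT.

Lemma path_prob_exists :
  exists P : probability (path_space A) R, is_path_prob w P.
Proof.
exists law => p n; rewrite /= /law; have [a [-> _]] := traj_cyl p n.
rewrite lebesgue_measure_itv/= lte_fin ltrDl lt_neqAle W_ge0 andbT eq_sym -/(W p n).
by case: eqP => [-> //|_] /=; rewrite -EFinD addrAC subrr add0r.
Qed.

End path_prob_exists.

Definition path_prob (R : realType) (Q S : finType) (A : pautomaton Q S)
  (w : nat -> S) : probability (path_space A) R :=
  sval (cid (path_prob_exists R A w)).
Arguments path_prob R {Q S} A w.

Lemma path_probP (R : realType) (Q S : finType) (A : pautomaton Q S)
  (w : nat -> S) : is_path_prob w (path_prob R A w).
Proof. exact: svalP (cid (path_prob_exists R A w)). Qed.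

(* Algorithms are mu-recursive functions. Arities are not tracked: a term is  *)
(* simply undefined on an argument list which is too short for it.            *)
Inductive murec : Type :=
| Zero
| Succ
| Proj of nat
| Comp of murec & seq murec
| PrimRec of murec & murec
| Mu of murec.

(* eval f xs y: the partial function denoted by f is defined on xs with       *)
(* value y. In PrimRec f g the recursion is on the first argument.            *)
Inductive eval : murec -> seq nat -> nat -> Prop :=
| eval_zero xs : eval Zero xs 0
| eval_succ x xs : eval Succ (x :: xs) x.+1
| eval_proj i xs : (i < size xs)%N -> eval (Proj i) xs (nth 0%N xs i)
| eval_comp f gs xs ys y :
    size ys = size gs ->
    (forall i, (i < size gs)%N -> eval (nth Zero gs i) xs (nth 0%N ys i)) ->
    eval f ys y -> eval (Comp f gs) xs y
| eval_rec0 f g xs y : eval f xs y -> eval (PrimRec f g) (0%N :: xs) y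
| eval_recS f g n xs y z :
    eval (PrimRec f g) (n :: xs) y -> eval g [:: n, y & xs] z ->
    eval (PrimRec f g) (n.+1 :: xs) z
| eval_mu f xs n (k : nat -> nat) :
    (forall m, (m < n)%N -> eval f (m :: xs) (k m).+1) ->
    eval f (n :: xs) 0 -> eval (Mu f) xs n.

(* Some algorithm answers correctly (1 for yes, 0 for no) whether P x holds,  *)
(* for every input x satisfying the promise D; nothing is required on other   *)
(* inputs.                                                                    *)
Definition decidable_on (I : Type) (code : I -> nat) (D P : I -> Prop) : Prop :=
  exists f : murec, forall x : I, D x ->
    exists b : bool, eval f [:: code x] b /\ (b <-> P x).

Record instance := Instance {
  nstates : nat ;
  nletters : nat ;
  automaton : pautomaton 'I_nstates 'I_nletters ;
  accepting : {set 'I_nstates} ;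
  threshold : rat ;
  threshold_itv : 0 < threshold < 1 }.

(* Only used for nonnegative rationals. *)
Definition rat_digits (x : rat) : seq nat := [:: `|numq x|%N; `|denq x|%N].

(* The inputs of an algorithm are numbers: an instance is written as a list   *)
(* of numbers, and lists are numbered by the bijection CodeSeq.code.          *)
Definition instance_code (X : instance) : nat :=
  CodeSeq.code (
    [:: nstates X; nletters X; val (init (automaton X))]
    ++ rat_digits (threshold X)
    ++ [seq nat_of_bool (q \in accepting X) | q <- enum 'I_(nstates X)]
    ++ flatten [seq flatten [seq flatten
         [seq rat_digits (trans (automaton X) a p q)
         | q <- enum 'I_(nstates X)]
         | p <- enum 'I_(nstates X)]
         | a <- enum 'I_(nletters X)])%SEQ.

Definition safety_equality (R : realType) (X : instance) : Prop :=
  exists w : nat -> 'I_(nletters X),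
    path_prob R (automaton X) w (safe (automaton X) (accepting X)) =
    (ratr (threshold X))%:E.

Definition reachability_equality (R : realType) (X : instance) : Prop :=
  exists w : nat -> 'I_(nletters X),
    path_prob R (automaton X) w (reach (automaton X) (accepting X)) =
    (ratr (threshold X))%:E.

(* Main.v *)
From HB Require Import structures.
From Pilot Require Import Defs.
From mathcomp Require Import all_boot all_order all_algebra.
From mathcomp Require Import all_classical all_reals all_analysis.
From mathcomp Require Import zify ring lra.

Set Implicit Arguments.
Unset Strict Implicit.
Unset Printing Implicit Defensive.

Import Order.TTheory GRing.Theory Num.Theory.
Import Pilot.Defs.

(* Given a supposed decider f, we construct one instance on which f errs.     *)
(* Every mu-recursive function is compiled to a nondeterministic register     *)
(* program with equality guards, and then to a control flow graph whose edges *)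
(* are the letters of an automaton. For a store y with constant coordinate 1  *)
(* and a coordinate for the program counter, the automaton holds, up to a     *)
(* positive factor, the vector of all y_i * y_j together with two             *)
(* accumulators Pos and Neg, where Pos - Neg is the sum of the squared guard  *)
(* defects met so far; linear updates of y act linearly on it, with natural   *)
(* coefficients, and missing mass goes to a neutral sink. A stop letter moves *)
(* everything to an accepting or a rejecting absorbing state and accepts with *)
(* probability 1/2 + const * (Pos - Neg), which is 1/2 iff the word describes *)
(* a correct halting run; words which never stop have probability 0 or 1.     *)
(* The input c of the computation enters through the first letter, which goes *)
(* to the distribution proportional to (1, c, c, c^2). As the rest of the     *)
(* instance does not depend on c, one can take c to be the code of that rest  *)
(* and let the machine recompute the code of its own instance, so that the    *)
(* equality holds iff f answers 0 on that code.                               *)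

(** An acceptance probability is linear in the distribution reached, whereas being a correct run is
    a conjunction of equations between counters. The two meet because a sum of squares vanishes only
    if every term does: the squared guard defects are quadratic in the store, hence linear in its
    tensor square, and a stochastic matrix can carry that square up to a positive factor. Any
    nonzero accumulated defect pushes the probability above 1/2, so equality with 1/2 tests exact
    simulation ([dist_run], [dist_stop]).

    Computations enter through [compile_sound] and [compile_complete], pass to flow graphs by
    [edges_sound] and [edges_complete], and to guarded letters by [accepting_run]. Safety and
    reachability share one argument: [prob_event] covers every event that holds on paths absorbed in
    [Acc], fails on paths absorbed in [Rej], and has a constant truth value on paths never absorbed.
    Together these give [event_eval]: some word attains 1/2 iff the simulated function returns 0 on
    its input.

    For the self-reference, [transition_digits_split] isolates the few digits of the instance that
    depend on the input [c]. Choosing [c] as the code of the others lets the machine rebuild the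
    code of its own instance ([eval_code_term]) and feed it to the supposed decider, whose answer is
    then wrong ([undecidable_of_diagonal]). *)

Lemma eval_inj f xs y y' : eval f xs y -> eval f xs y' -> y = y'.
Proof.
move=> h; elim: h y' => {f xs y}.
- by move=> xs y' h; inversion h.
- by move=> x xs y' h; inversion h.
- by move=> i xs lt_i y' h; inversion h.
- move=> f gs xs ys y sz _ IHgs _ IHf y' h.
  inversion h as [| | |f0 gs0 xs0 ys' y0 sz' evgs evf| | |]; subst.
  apply: IHf; suff -> : ys = ys' by [].
  apply: (@eq_from_nth _ 0); first by rewrite sz.
  by move=> i; rewrite sz => lt_i; apply: IHgs => //; exact: evgs.
- by move=> f g xs y _ IH y' h; inversion h; apply: IH.
- move=> f g n xs y z _ IHrec _ IHg y' h.
  inversion h as [| | | | |f0 g0 n0 xs0 u z0 evrec evg|]; subst.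
  by apply: IHg; rewrite (IHrec _ evrec).
- move=> f xs n k _ IHk _ IH0 y' h.
  inversion h as [| | | | | |f0 xs0 n0 k' evk ev0]; subst.
  case: (ltngtP n y') => // lt_n.
  + by have := IH0 _ (evk _ lt_n).
  + by have := IHk _ lt_n _ ev0.
Qed.

(** The recursion of [murec] passes through a list in [Comp], so the induction hypothesis for the
    members of that list is supplied by hand, in the [nth] form used by [eval_comp]. *)
Lemma murec_nested_ind (P : murec -> Prop) :
  P Zero -> P Succ -> (forall i, P (Proj i)) ->
  (forall f gs, P f -> (forall i, i < size gs -> P (nth Zero gs i)) ->
    P (Comp f gs)) ->
  (forall f g, P f -> P g -> P (PrimRec f g)) ->
  (forall f, P f -> P (Mu f)) ->
  forall f, P f.
Proof.
move=> P0 PS Pp Pc Pr Pm; fix IH 1 => f; case: f => [| |i|f gs|f g|f].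
- exact: P0.
- exact: PS.
- exact: Pp.
- apply: Pc; first exact: IH.
  elim: gs => [|g gs IHgs] i lt_i; first by discriminate lt_i.
  by case: i lt_i => [_|i]; [exact: (IH g) | exact: IHgs].
- by apply: Pr; exact: IH.
- by apply: Pm; exact: IH.
Qed.

(** * Register programs *)

(** A list of registers, with repetitions, stands for a linear form with natural coefficients.
    Linearity of all guards and updates is what the automaton will rely on. *)
Definition value (e : seq nat) (x : nat -> nat) : nat := sumn (map x e).

Record op := Op { lhs : seq nat; rhs : seq nat; tgt : nat; src : seq nat }.

Definition enabled (o : op) (x : nat -> nat) : Prop :=
  value (lhs o) x = value (rhs o) x.

Definition update (o : op) (x : nat -> nat) : nat -> nat :=
  fun r => if r == tgt o then value (src o) x else x r.

Inductive prog := Do of op | Then of prog & prog | Loop of prog.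

Inductive star (T : Type) (r : T -> T -> Prop) : T -> T -> Prop :=
| star_refl x : star r x x
| star_step x y z : star r x y -> r y z -> star r x z.

Fixpoint sem (p : prog) : (nat -> nat) -> (nat -> nat) -> Prop :=
  match p with
  | Do o => fun x x' => enabled o x /\ x' = update o x
  | Then p q => fun x x' => exists2 z, sem p x z & sem q z x'
  | Loop p => star (sem p)
  end.

(* Register 0 is meant to hold the constant 1, so that [:: a; 0] denotes a + 1. *)
Definition assign (r : nat) (e : seq nat) : prog := Do (Op [::] [::] r e).
Definition check (e e' : seq nat) : prog := Do (Op e e' 1 [:: 1]).

(** Registers from [n] on are scratch space. [Loop] guesses its number of rounds and a later [check]
    confirms the guess; [check [:: 0] [::]] asks for 1 = 0 and blocks, while [check [::] [::]]
    always passes. *)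
Fixpoint compile (f : murec) (args : seq nat) (out n : nat) : prog :=
  match f with
  | Zero => assign out [::]
  | Succ => if args is a :: _ then assign out [:: a; 0] else check [:: 0] [::]
  | Proj i =>
      if i < size args then assign out [:: nth 0 args i] else check [:: 0] [::]
  | Comp f gs =>
      let m := n + size gs in
      Then ((fix compile_all gs j :=
               if gs is g :: gs' then
                 Then (compile g args j m) (compile_all gs' j.+1)
               else check [::] [::]) gs n)
           (compile f (iota n (size gs)) out m)
  | PrimRec f g =>
      if args is a :: args' then
        Then (assign n [::])
       (Then (compile f args' n.+1 n.+3)
       (Then (Loop (Then (compile g [:: n, n.+1 & args'] n.+2 n.+3)
                   (Then (assign n.+1 [:: n.+2]) (assign n [:: n; 0]))))
       (Then (check [:: n] [:: a]) (assign out [:: n.+1]))))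
      else check [:: 0] [::]
  | Mu f =>
      Then (assign n [::])
     (Then (Loop (Then (compile f (n :: args) n.+1 n.+3)
                 (* passing the check means that register n.+1 is positive *)
                 (Then (assign n.+2 [:: 0])
                 (Then (Loop (assign n.+2 [:: n.+2; 0]))
                 (Then (check [:: n.+1] [:: n.+2]) (assign n [:: n; 0]))))))
     (Then (compile f (n :: args) n.+1 n.+3)
     (Then (check [:: n.+1] [::]) (assign out [:: n]))))
  end.

(** The anonymous fixpoint inside [compile], named so that statements about it can be proved by
    induction on the list. *)
Definition compile_all (args : seq nat) (m : nat) :=
  fix compile_all (gs : seq murec) (j : nat) : prog :=
    if gs is g :: gs' then Then (compile g args j m) (compile_all gs' j.+1)
    else check [::] [::].

Lemma sem_assign r e x x' :
  sem (assign r e) x x' <-> x' = fun i => if i == r then value e x else x i.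
Proof. by split=> [[_ ->]|->]. Qed.

Lemma sem_check e e' x x' :
  sem (check e e') x x' <-> value e x = value e' x /\ x' = x.
Proof.
have upd1 : update (Op e e' 1 [:: 1]) x = x.
  by apply/funext => i; rewrite /update /value /= addn0; case: eqP => [->|].
by split=> -[? ->]; split=> //; rewrite upd1.
Qed.

(** Partial correctness together with a frame condition: below [n] only [out] may change. The frame
    is what lets subprograms be composed. *)
Definition sound (f : murec) : Prop := forall args out n x x',
  all (fun r => r < n) args -> 0 < out < n -> x 0 = 1 ->
  sem (compile f args out n) x x' ->
  eval f (map x args) (x' out) /\
  (forall r, r < n -> r != out -> x' r = x r).

Definition complete (f : murec) : Prop := forall args out n x y,
  all (fun r => r < n) args -> 0 < out < n -> x 0 = 1 ->
  eval f (map x args) y ->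
  exists2 x', sem (compile f args out n) x x' & x' out = y.

Lemma map_agree (args : seq nat) n (x x' : nat -> nat) :
  all (fun r => r < n) args -> (forall r, r < n -> x' r = x r) ->
  map x' args = map x args.
Proof. by move=> /allP lt_n agree; apply/eq_in_map => r /lt_n; exact: agree. Qed.

Lemma compile_all_sound args m gs : forall j x x',
  (forall i, i < size gs -> sound (nth Zero gs i)) ->
  all (fun r => r < j) args -> 0 < j -> j + size gs <= m -> x 0 = 1 ->
  sem (compile_all args m gs j) x x' ->
  (forall i, i < size gs -> eval (nth Zero gs i) (map x args) (x' (j + i))) /\
  (forall r, r < j -> x' r = x r) .
Proof.
elim: gs => [|g gs IHgs] j x x' IH argsj j0 jm x0 /=.
  by case/sem_check => _ ->.
rewrite /= in jm; case=> z hg hgs.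
have argsm : all (fun r => r < m) args.
  by apply: sub_all argsj => r; lia.
have lt_jm : 0 < j < m by lia.
have [ev fr] := IH 0 isT args j m x z argsm lt_jm x0 hg.
have frj r : r < j -> z r = x r by move=> rj; apply: fr; lia.
have z0 : z 0 = 1 by rewrite frj.
have argsj1 : all (fun r => r < j.+1) args by apply: sub_all argsj => r; lia.
have jm1 : j.+1 + size gs <= m by lia.
have [ev' fr'] := IHgs j.+1 z x' (fun i => IH i.+1) argsj1 isT jm1 z0 hgs.
split=> [[_|i lti]|r rj].
- by rewrite addn0 fr' //=; exact: ev.
- by rewrite -(map_agree argsj frj) addnS -addSn; exact: ev'.
- by rewrite fr' ?frj //; lia.
Qed.

Lemma compile_sound f : sound f.
Proof.
elim/murec_nested_ind: f.
- move=> args out n x x' _ _ _ /sem_assign ->; split=> [|r _ /negbTE -> //].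
  by rewrite eqxx; exact: eval_zero.
- case=> [|a args] out n x x' _ _ x0; first by case/sem_check; rewrite /value /= x0.
  move=> /sem_assign ->; split=> [|r _ /negbTE -> //].
  by rewrite eqxx /value /= x0 addn0 addn1; exact: eval_succ.
- move=> i args out n x x' _ _ x0 /=; case: ifP => lt_i; last first.
    by case/sem_check; rewrite /value /= x0.
  move=> /sem_assign ->; split=> [|r _ /negbTE -> //].
  rewrite eqxx /value /= addn0 -(nth_map 0 0) //; apply: eval_proj.
  by rewrite size_map.
- move=> f gs IHf IHgs args out n x x' lt_args lt_out x0 [z hgs hf].
  have n0 : 0 < n by lia.
  have [evgs fr] := compile_all_sound IHgs lt_args n0 (leqnn _) x0 hgs.
  have lt_iota : all (fun r => r < n + size gs) (iota n (size gs)).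
    by apply/allP => r; rewrite mem_iota => /andP[].
  have lt_out' : 0 < out < n + size gs by lia.
  have z0 : z 0 = 1 by rewrite fr.
  have [evf fr'] := IHf _ _ _ _ _ lt_iota lt_out' z0 hf.
  split=> [|r ltr neq]; last by rewrite fr' ?fr //; lia.
  apply: eval_comp evf; first by rewrite size_map size_iota.
  move=> i lti; rewrite (nth_map 0) ?size_iota // nth_iota //.
  exact: evgs.
- move=> f g IHf IHg [|a args] out n x x' /=.
    by move=> _ _ x0 /sem_check []; rewrite /value /= x0.
  case/andP=> lt_a lt_args lt_out x0.
  case=> x1 /sem_assign ex1 [x2 hf] [x3 hloop] [x4 /sem_check[ea ->]].
  move/sem_assign => ->; rewrite /value /= eqxx !addn0 in ea *.
  have lt3 : all (fun r => r < n.+3) args by apply: sub_all lt_args => r; lia.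
  have lt_acc : 0 < n.+1 < n.+3 by lia.
  have fr1 r : r < n -> x1 r = x r by move=> ?; rewrite ex1; case: eqP => //; lia.
  have x10 : x1 0 = 1 by rewrite fr1 //; lia.
  have [evf frf] := IHf _ _ _ _ _ lt3 lt_acc x10 hf.
  have fr2 r : r < n -> x2 r = x r by move=> ?; rewrite frf ?fr1 //; lia.
  (* Loop invariant: register [n.+1] holds the value of the recursion at the counter in register
     [n]. *)
  suff [evr fr3] : eval (PrimRec f g) (x3 n :: map x args) (x3 n.+1) /\
      (forall r, r < n -> x3 r = x r).
    split=> [|r lt_r /negbTE ->]; last exact: fr3.
    by rewrite -(fr3 _ lt_a) -ea.
  move: fr2 evf; rewrite (map_agree lt_args fr1).
  have : x2 n = 0 by rewrite frf ?ex1 ?eqxx //; lia.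
  elim: hloop => {x1 x2 x3 x4 ex1 hf fr1 x10 ea frf} [y yn fr ev|].
    by split=> //; rewrite yn; exact: eval_rec0.
  move=> y1 y2 y3 _ IH [u hg [v /sem_assign ev /sem_assign ey]] yn fr evf.
  have {IH} [evr fr2] := IH yn fr evf.
  have lt3' : all (fun r => r < n.+3) [:: n, n.+1 & args].
    by rewrite /= lt3 !ltnS leqnSn leqW.
  have lt_tmp : 0 < n.+2 < n.+3 by lia.
  have y20 : y2 0 = 1 by rewrite fr2 //; lia.
  have [evg frg] := IHg _ _ _ _ _ lt3' lt_tmp y20 hg.
  have un : u n = y2 n by apply: frg; lia.
  rewrite ey ev /value /= !eqxx !addn0.
  have [-> ->] : (n.+1 == n = false) /\ (n == n.+1 = false) by split; lia.
  split=> [|r ltr]; last first.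
    have [-> ->] : (r == n = false) /\ (r == n.+1 = false) by split; lia.
    by rewrite frg ?fr2 //; lia.
  have -> : u 0 = 1 by rewrite frg //; lia.
  rewrite un addn1; apply: eval_recS evr _.
  by rewrite /= (map_agree lt_args fr2) in evg.
- move=> f IHf args out n x x' lt_args lt_out x0 /=.
  case=> x1 /sem_assign ex1 [x2 hloop] [x3 hf] [x4 /sem_check[ea ->]].
  move/sem_assign => ->; rewrite /value /= eqxx !addn0 in ea *.
  have lt3 : all (fun r => r < n.+3) (n :: args).
    by rewrite /= leqW //=; apply: sub_all lt_args => r; lia.
  have lt_t : 0 < n.+1 < n.+3 by lia.
  have fr1 r : r < n -> x1 r = x r by move=> ?; rewrite ex1; case: eqP => //; lia.
  suff [evs fr2] : (forall m, m < x2 n ->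
        exists k, eval f (m :: map x args) k.+1) /\
      (forall r, r < n -> x2 r = x r).
    have x20 : x2 0 = 1 by rewrite fr2 //; lia.
    have [evf frf] := IHf _ _ _ _ _ lt3 lt_t x20 hf.
    rewrite ea /= (map_agree lt_args fr2) in evf.
    rewrite frf; [|lia..].
    split=> [|r lt_r /negbTE ->]; last by rewrite frf ?fr2 //; lia.
    (* [eval_mu] asks for one function giving all the positive values met before the zero. *)
    have /choice[k evk] : forall m, exists k,
        m < x2 n -> eval f (m :: map x args) k.+1.
      move=> m; case: (ltnP m (x2 n)) => [/evs[k] ?|_]; first by exists k.
      by exists 0.
    exact: (eval_mu evk evf).
  have : x1 n = 0 by rewrite ex1 eqxx.
  elim: hloop fr1 => {x2 x3 x4 hf ea x1 ex1} [y fr yn|].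
    by split=> // m; rewrite yn.
  move=> y1 y2 y3 _ IH [z1 hf [z2 /sem_assign ez2 [z3 hu]]] + fr yn.
  case=> z4 /sem_check[ez ->] /sem_assign ey.
  have {IH} [evs fr2] := IH fr yn.
  have y20 : y2 0 = 1 by rewrite fr2 //; lia.
  have [evf frf] := IHf _ _ _ _ _ lt3 lt_t y20 hf.
  (* The inner loop starts at 1 and only increments, so whatever number of rounds it takes, equality
     with [n.+2] forces the value of [f] in [n.+1] to be positive. *)
  have [z3_gt0 fr3] : 0 < z3 n.+2 /\ (forall r, r < n.+2 -> z3 r = z1 r).
    have : 0 < z2 n.+2 /\ (forall r, r < n.+2 -> z2 r = z1 r).
      rewrite ez2 eqxx /value /= frf ?y20; [split=> // r ltr| lia..].
      by rewrite ltn_eqF.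
    elim: hu => {ez2 z3 ez ey} [//|t1 t2 t3 _ IH /sem_assign -> /IH [gt0 fr2']].
    rewrite eqxx /value /=; split=> [|r ltr]; first by lia.
    by rewrite ltn_eqF ?fr2'.
  have z3n : z3 n = y2 n by rewrite fr3 ?frf //; lia.
  have z30 : z3 0 = 1 by rewrite fr3 ?frf //; lia.
  rewrite /value /= !addn0 in ez.
  have -> : y3 n = (y2 n).+1 by rewrite ey eqxx /value /= z3n z30 addn0 addn1.
  split=> [m|r ltr]; last by rewrite ey ltn_eqF // fr3 ?frf ?fr2 //; lia.
  rewrite ltnS leq_eqVlt => /orP[/eqP ->|]; last exact: evs.
  exists (z3 n.+2).-1; rewrite prednK // -ez fr3 //.
  by rewrite /= (map_agree lt_args fr2) in evf.
Qed.

Lemma compile_all_complete args m ys gs : forall j x,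
  (forall i, i < size gs -> complete (nth Zero gs i)) ->
  all (fun r => r < j) args -> 0 < j -> j + size gs <= m -> x 0 = 1 ->
  (forall i, i < size gs -> eval (nth Zero gs i) (map x args) (ys i)) ->
  exists2 x', sem (compile_all args m gs j) x x' &
    forall i, i < size gs -> x' (j + i) = ys i.
Proof.
elim: gs ys => [|g gs IHgs] ys j x IH argsj j0 jm x0 ev /=.
  by exists x => //; apply/sem_check.
rewrite /= in jm.
have argsm : all (fun r => r < m) args by apply: sub_all argsj => r; lia.
have lt_jm : 0 < j < m by lia.
have [z hg zj] := IH 0 isT args j m x _ argsm lt_jm x0 (ev 0 isT).
have [_ fr] := compile_sound argsm lt_jm x0 hg.
have frj r : r < j -> z r = x r by move=> rj; apply: fr; lia.
have z0 : z 0 = 1 by rewrite frj.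
have argsj1 : all (fun r => r < j.+1) args by apply: sub_all argsj => r; lia.
have jm1 : j.+1 + size gs <= m by lia.
have ev' i : i < size gs -> eval (nth Zero gs i) (map z args) (ys i.+1).
  by rewrite (map_agree argsj frj); exact: (ev i.+1).
have [x' hgs x'j] :=
  IHgs (ys \o succn) j.+1 z (fun i => IH i.+1) argsj1 isT jm1 z0 ev'.
have [_ fr'] := compile_all_sound (fun i _ => @compile_sound _) argsj1 isT jm1 z0 hgs.
exists x'; first by exists z.
by case=> [_|i lti]; [rewrite addn0 fr' | rewrite addnS -addSn x'j].
Qed.

Lemma compile_complete f : complete f.
Proof.
elim/murec_nested_ind: f.
- move=> args out n x y _ _ _ ev; inversion ev; subst.
  by eexists; [apply/sem_assign; reflexivity | rewrite /= eqxx].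
- move=> [|a args] out n x y _ _ x0 ev; inversion ev; subst.
  eexists; first by apply/sem_assign; reflexivity.
  by rewrite /= eqxx /value /= x0 addn0 addn1.
- move=> i args out n x y _ _ x0 ev; inversion ev; subst.
  rewrite size_map in H0; rewrite /= H0; eexists.
    by apply/sem_assign; reflexivity.
  by rewrite /= eqxx /value /= addn0 (nth_map 0).
- move=> f gs IHf IHgs args out n x y lt_args lt_out x0 ev.
  inversion ev as [| | |f0 gs0 xs0 ys y0 sz evgs evf| | |]; subst.
  have n0 : 0 < n by lia.
  have [z hgs zn] := compile_all_complete IHgs lt_args n0 (leqnn _) x0 evgs.
  have [_ fr] := compile_all_sound (fun i _ => @compile_sound _) lt_args n0
    (leqnn _) x0 hgs.
  have lt_iota : all (fun r => r < n + size gs) (iota n (size gs)).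
    by apply/allP => r; rewrite mem_iota => /andP[].
  have lt_out' : 0 < out < n + size gs by lia.
  have z0 : z 0 = 1 by rewrite fr.
  have [|x' hf x'out] := IHf _ _ _ z y lt_iota lt_out' z0; last first.
    by exists x' => //; exists z.
  suff -> : map z (iota n (size gs)) = ys by [].
  apply: (@eq_from_nth _ 0); first by rewrite size_map size_iota.
  move=> i; rewrite size_map size_iota => lti.
  by rewrite (nth_map 0) ?size_iota // nth_iota // zn.
- move=> f g IHf IHg [|a args] out n x y /=.
    by move=> _ _ _ ev; inversion ev.
  case/andP=> lt_a lt_args lt_out x0 ev.
  have lt3 : all (fun r => r < n.+3) args by apply: sub_all lt_args => r; lia.
  have lt_acc : 0 < n.+1 < n.+3 by lia.
  pose x1 r := if r == n then 0 else x r.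
  have fr1 r : r < n -> x1 r = x r by move=> ?; rewrite /x1; case: eqP => //; lia.
  have x10 : x1 0 = 1 by rewrite fr1 //; lia.
  (* The base value is found by unwinding the derivation down to argument 0. *)
  have [v evf] : exists v, eval f (map x args) v.
    move: ev; elim: (x a) y => [|k IH] y ev; inversion ev; subst; first by exists y.
    exact: IH H4.
  rewrite -(map_agree lt_args fr1) in evf.
  have [x2 hf x2v] := IHf _ _ _ _ _ lt3 lt_acc x10 evf.
  have [_ frf] := compile_sound lt3 lt_acc x10 hf.
  have fr2 r : r < n -> x2 r = x r by move=> ?; rewrite frf ?fr1 //; lia.
  have x2n : x2 n = 0 by rewrite frf /x1 ?eqxx //; lia.
  suff [x3 hloop [x3n x3acc fr3]] :
      exists2 x3, star (sem (Then (compile g [:: n, n.+1 & args] n.+2 n.+3)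
                  (Then (assign n.+1 [:: n.+2]) (assign n [:: n; 0])))) x2 x3 &
        [/\ x3 n = x a, x3 n.+1 = y & forall r, r < n -> x3 r = x r].
    eexists.
      exists x1; first by apply/sem_assign.
      exists x2 => //; exists x3 => //.
      exists x3; last by apply/sem_assign; reflexivity.
      by apply/sem_check; rewrite /value /= x3n fr3.
    by rewrite /= eqxx /value /= addn0.
  move: ev; elim: (x a) y => [|k IH] y ev.
    exists x2; first exact: star_refl.
    split=> //; rewrite x2v; rewrite (map_agree lt_args fr1) in evf.
    by inversion ev as [| | | |f0 g0 xs0 y0 ev0| |]; subst; apply: eval_inj ev0.
  inversion ev as [| | | | |f0 g0 n0 xs0 u z0 evrec evg|]; subst.
  have [x3 hloop [x3n x3u fr3]] := IH _ evrec.
  have lt3' : all (fun r => r < n.+3) [:: n, n.+1 & args].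
    by rewrite /= lt3 !ltnS leqnSn leqW.
  have lt_tmp : 0 < n.+2 < n.+3 by lia.
  have x30 : x3 0 = 1 by rewrite fr3 //; lia.
  rewrite -(map_agree lt_args fr3) -x3n -x3u in evg.
  have [x4 hg x4y] := IHg _ _ _ _ _ lt3' lt_tmp x30 evg.
  have [_ frg] := compile_sound lt3' lt_tmp x30 hg.
  eexists.
    apply: star_step hloop _; exists x4 => //.
    by eexists; apply/sem_assign; reflexivity.
  rewrite /value /= !eqxx !addn0.
  have [-> ->] : (n.+1 == n = false) /\ (n == n.+1 = false) by split; lia.
  split=> [|//|r ltr]; last first.
    have [-> ->] : (r == n = false) /\ (r == n.+1 = false) by split; lia.
    by rewrite frg ?fr3 //; lia.
  have -> : x4 0 = 1 by rewrite frg //; lia.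
  by rewrite frg ?x3n ?addn1 //; lia.
- move=> f IHf args out n x y lt_args lt_out x0 ev.
  inversion ev as [| | | | | |f0 xs0 y0 k evk ev0]; subst.
  have lt3 : all (fun r => r < n.+3) (n :: args).
    by rewrite /= leqW //=; apply: sub_all lt_args => r; lia.
  have lt_t : 0 < n.+1 < n.+3 by lia.
  pose x1 r := if r == n then 0 else x r.
  have fr1 r : r < n -> x1 r = x r by move=> ?; rewrite /x1; case: eqP => //; lia.
  suff [x2 hloop [x2n fr2]] :
      exists2 x2, sem (Loop (Then (compile f (n :: args) n.+1 n.+3)
                 (Then (assign n.+2 [:: 0])
                 (Then (Loop (assign n.+2 [:: n.+2; 0]))
                 (Then (check [:: n.+1] [:: n.+2]) (assign n [:: n; 0])))))) x1 x2 &
        x2 n = y /\ forall r, r < n -> x2 r = x r.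
    have x20 : x2 0 = 1 by rewrite fr2 //; lia.
    rewrite -(map_agree lt_args fr2) -x2n in ev0.
    have [x3 hf x3t] := IHf _ _ _ _ _ lt3 lt_t x20 ev0.
    have [_ frf] := compile_sound lt3 lt_t x20 hf.
    eexists.
      exists x1; first by apply/sem_assign.
      exists x2 => //; exists x3 => //.
      exists x3; last by apply/sem_assign; reflexivity.
      by apply/sem_check; rewrite /value /= x3t.
    by rewrite /= eqxx /value /= frf ?addn0 //; lia.
  move: evk; elim: y {ev ev0} => [|m IH] evk.
    by exists x1; [exact: star_refl | rewrite /x1 eqxx].
  have [|x2 hloop [x2n fr2]] := IH; first by move=> i lti; apply: evk; lia.
  have x20 : x2 0 = 1 by rewrite fr2 //; lia.
  have {evk} := evk m (leqnn _); rewrite -(map_agree lt_args fr2) -x2n => evk.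
  have [x3 hf x3t] := IHf _ _ _ _ _ lt3 lt_t x20 evk.
  have [_ frf] := compile_sound lt3 lt_t x20 hf.
  have x30 : x3 0 = 1 by rewrite frf ?x20 //; lia.
  (* The store after [j] rounds of the inner loop. The right guess is [k (x2 n)], one less than the
     value of [f], since the count starts at 1. *)
  pose x4 j r := if r == n.+2 then j.+1 else x3 r.
  have hcount j : sem (Loop (assign n.+2 [:: n.+2; 0])) (x4 0) (x4 j).
    elim: j => [|j IHj]; first exact: star_refl.
    apply: star_step IHj _; apply/sem_assign/funext => r.
    by rewrite /x4 /value /= eqxx x30 addn0 addn1; case: eqP.
  eexists.
    apply: star_step hloop _; exists x3 => //.
    exists (x4 0).
      by apply/sem_assign/funext => r; rewrite /x4 /value /= x30.
    exists (x4 (k (x2 n))); first exact: hcount.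
    exists (x4 (k (x2 n))); last by apply/sem_assign; reflexivity.
    apply/sem_check; split=> //; rewrite /value /= /x4 eqxx x3t.
    by rewrite ltn_eqF.
  rewrite /= eqxx /value /= /x4 x30 addn0; split=> [|r ltr].
    by rewrite ltn_eqF // frf ?x2n ?addn1 //; lia.
  by rewrite !ltn_eqF ?frf ?fr2 //; lia.
Qed.

(** * Control flow graphs *)

Definition op_tuple (o : op) := (lhs o, rhs o, tgt o, src o).
Definition tuple_op (u : seq nat * seq nat * nat * seq nat) : op :=
  let: (l, r, t, s) := u in Op l r t s.
Lemma op_tupleK : cancel op_tuple tuple_op. Proof. by case. Qed.
HB.instance Definition _ := Equality.copy op (can_type op_tupleK).

Definition skip_op := Op [::] [::] 1 [:: 1].

Definition edge := (nat * op * nat)%type.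

Fixpoint nlabels (p : prog) : nat :=
  match p with
  | Do _ => 0
  | Then p q => (nlabels p + nlabels q).+1
  | Loop p => (nlabels p).+1
  end.

(* The control flow graph of p with entry s and exit t; its inner nodes are   *)
(* the labels n, ..., n + nlabels p - 1.                                      *)
Fixpoint edges (p : prog) (s t n : nat) : seq edge :=
  match p with
  | Do o => [:: (s, o, t)]
  | Then p q => edges p s n n.+1 ++ edges q n t (n + nlabels p).+1
  | Loop p => [:: (s, skip_op, n), (n, skip_op, t) & edges p n n n.+1]
  end.

Lemma update_skip x : update skip_op x = x.
Proof.
by apply/funext => r; rewrite /update /value /= addn0; case: eqP => [->|].
Qed.

Fixpoint trace (u : seq edge) (l : nat) (x : nat -> nat) (l' : nat)
    (x' : nat -> nat) : Prop :=
  if u is (s, o, t) :: u' then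
    [/\ l = s, enabled o x & trace u' t (update o x) l' x']
  else l = l' /\ x = x'.

Lemma trace_cat u v l x m y l' x' :
  trace u l x m y -> trace v m y l' x' -> trace (u ++ v) l x l' x'.
Proof.
elim: u l x => [|[[s o] t] u IH] l x /=; first by case=> -> ->.
by case=> ls en tr tr'; split=> //; exact: IH tr tr'.
Qed.

Lemma trace_rcons u s o t l x l' x' :
  trace (rcons u (s, o, t)) l x l' x' <->
  exists y, [/\ trace u l x s y, enabled o y, l' = t & x' = update o y].
Proof.
elim: u l x => [|[[s1 o1] t1] u IH] l x /=.
  split=> [[-> en [<- <-]]|[y [[-> <-] en -> ->]]] //.
  by exists x.
split=> [[ls en /IH[y [tr eny el ex]]]|[y [[ls en tr] eny el ex]]].
  by exists y.
by split=> //; apply/IH; exists y.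
Qed.

Lemma edges_complete p s t n x x' : sem p x x' ->
  exists2 u, {subset u <= edges p s t n} & trace u s x t x'.
Proof.
elim: p s t n x x' => [op0|p IHp q IHq|p IHp] s t n x x' /=.
- by case=> en ->; exists [:: (s, op0, t)].
- case=> z hp hq; have [u su tu] := IHp s n n.+1 _ _ hp.
  have [v sv tv] := IHq n t (n + nlabels p).+1 _ _ hq.
  exists (u ++ v); last exact: trace_cat tu tv.
  by move=> e; rewrite !mem_cat => /orP[/su ->|/sv ->]; rewrite ?orbT.
- move=> hstar.
  suff [u su tu] : exists2 u, {subset u <= edges p n n n.+1} & trace u n x n x'.
    exists ((s, skip_op, n) :: rcons u (n, skip_op, t)).
      move=> e; rewrite in_cons mem_rcons in_cons => /or3P[/eqP ->|/eqP ->|/su e_in].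
      + by rewrite in_cons eqxx.
      + by rewrite !in_cons eqxx orbT.
      + by rewrite !in_cons e_in !orbT.
    split=> //; rewrite update_skip; apply/trace_rcons; exists x'.
    by rewrite update_skip.
  elim: hstar => {x x'} [x|x y z _ [u su tu] hp]; first by exists [::].
  have [v sv tv] := IHp n n n.+1 _ _ hp.
  exists (u ++ v); last exact: trace_cat tu tv.
  by move=> e; rewrite mem_cat => /orP[/su ->|/sv ->].
Qed.

Definition preserves (J : nat -> (nat -> nat) -> Prop) (e : edge) : Prop :=
  forall x, J e.1.1 x -> enabled e.1.2 x -> J e.2 (update e.1.2 x).

(* Every pre-/postcondition pair for p extends to an inductive invariant of   *)
(* its control flow graph.                                                    *)
Lemma edges_invariant p s t n (J : nat -> (nat -> nat) -> Prop) :
  s < n -> t < n -> (forall x x', J s x -> sem p x x' -> J t x') ->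
  exists2 J', forall l, l < n -> J' l = J l &
    forall e : edge, e \in edges p s t n -> preserves J' e.
Proof.
(* Inner nodes of different subprograms are disjoint, so extending the invariant to the second part
   of a [Then] leaves it intact on the edges of the first. *)
have edge_lt : forall p s t n (e : edge), s < n -> t < n -> e \in edges p s t n ->
    e.1.1 < n + nlabels p /\ e.2 < n + nlabels p.
  elim=> {p s t n} [op0|p IHp q IHq|p IHp] s t n e ltsn lttn /=.
  - by rewrite mem_seq1 => /eqP -> /=; rewrite addn0.
  - rewrite mem_cat => /orP[/IHp|/IHq] IH.
      by have [||? ?] := IH; [lia..|split; lia].
    by have [||? ?] := IH; [lia..|split; lia].
  - rewrite !in_cons => /or3P[/eqP ->|/eqP ->|/IHp IH] /=; [split; lia..|].
    by have [||? ?] := IH; [lia..|split; lia].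
elim: p s t n J => [op0|p IHp q IHq|p IHp] s t n J ltsn lttn hJ /=.
- exists J => // e; rewrite mem_seq1 => /eqP -> x /= Jx en.
  by apply: hJ Jx _.
(* The middle node receives the strongest postcondition of the first part. *)
- pose J0 l x' := if l == n then exists2 x, J s x & sem p x x' else J l x'.
  have J0n x' : J0 n x' = exists2 x, J s x & sem p x x' by rewrite /J0 eqxx.
  have J0lt l : l < n -> J0 l = J l.
    by move=> ltl; apply/funext => x; rewrite /J0 ltn_eqF.
  have [||x x' Js hp|J1 J1lt J1e] := IHp s n n.+1 J0; [by lia|by []| |].
    by rewrite J0n; exists x; rewrite // -J0lt.
  have [|||J2 J2lt J2e] := IHq n t (n + nlabels p).+1 J1; [by lia|by lia| |].
    move=> x x'; rewrite !J1lt; [|lia..]; rewrite J0n J0lt // => -[y Jy hp] hq.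
    by apply: hJ Jy _; exists x.
  exists J2 => [l ltl|e]; first by rewrite J2lt ?J1lt ?J0lt //; lia.
  rewrite mem_cat => /orP[e_in|/J2e //].
  have [//|//|lt1 lt2] := edge_lt p s n n.+1 e _ _ e_in; first by lia.
  by have := J1e _ e_in; rewrite /preserves !J2lt //; lia.
- pose J0 l x' := if l == n then exists2 x, J s x & star (sem p) x x' else J l x'.
  have J0n x' : J0 n x' = exists2 x, J s x & star (sem p) x x'.
    by rewrite /J0 eqxx.
  have J0lt l : l < n -> J0 l = J l.
    by move=> ltl; apply/funext => x; rewrite /J0 ltn_eqF.
  have [//|//||J1 J1lt J1e] := IHp n n n.+1 J0.
    move=> x x'; rewrite !J0n => -[y Jy hy] hp; exists y => //.
    exact: star_step hy hp.
  exists J1 => [l ltl|e]; first by rewrite J1lt ?J0lt ?leqW.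
  rewrite !in_cons => /or3P[/eqP ->|/eqP ->|/J1e //] x /=.
  + rewrite update_skip !J1lt; [|lia..]; rewrite J0n J0lt // => Jx _.
    by exists x => //; exact: star_refl.
  + rewrite update_skip !J1lt; [|lia..]; rewrite J0n J0lt // => -[y Jy hy] _.
    exact: hJ Jy hy.
Qed.

(** Apply the invariant that says the store is [x] at [s], and reachable from [x] by [p] at [t]; the
    two clauses are compatible because [s] and [t] differ. *)
Lemma edges_sound p s t n u x x' : s < n -> t < n -> s != t ->
  {subset u <= edges p s t n} -> trace u s x t x' -> sem p x x'.
Proof.
move=> ltsn lttn neq su tu.
pose J l y := if l == s then y = x else sem p x y.
have [|J' J'lt J'e] := @edges_invariant p s t n J ltsn lttn.
  by move=> y y'; rewrite /J eqxx eq_sym (negbTE neq) => ->.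
suff : J' t x' by rewrite J'lt // /J eq_sym (negbTE neq).
have : J' s x by rewrite J'lt // /J eqxx.
elim: u {2 3}s {1 2}x su tu => [|[[s1 o] t1] u IH] l y su /=; first by case=> -> ->.
case=> -> en tr Jy; apply: IH tr _ => [e e_in|].
  by apply: su; rewrite in_cons e_in orbT.
by apply: (J'e (s1, o, t1)) => //; apply: su; rewrite mem_head.
Qed.

(** * The law of a path *)

Section path_measure.
Local Open Scope classical_set_scope.
Local Open Scope ring_scope.
Variables (R : realType) (Q S : finType) (A : pautomaton Q S) (w : nat -> S).
Local Notation P := (path_prob R A w).

Fixpoint dist (n : nat) (q : Q) : rat :=
  if n is m.+1 then \sum_p dist m p * trans A (w m) p q else (q == init A)%:R.

Lemma dist_sum1 n : \sum_q dist n q = 1.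
Proof.
elim: n => [|n IHn] /=.
  rewrite (bigD1 (init A)) //= eqxx big1 ?addr0 // => q /negbTE.
  by rewrite eq_sym => ->.
rewrite exchange_big /= -[RHS]IHn; apply: eq_bigr => p _.
by rewrite -mulr_sumr trans_sum1 mulr1.
Qed.

Lemma path_prob_fin_bigcup (I : finType) (phi : pred I)
    (F : I -> set (path_space A)) (E : set (path_space A)) :
  (forall i, measurable (F i)) -> trivIset setT F ->
  (forall x, E x <-> exists2 i, phi i & F i x) ->
  P E = (\sum_(i | phi i) P (F i))%E.
Proof.
move=> mF tF hE.
have -> : E = \bigcup_(i in [set` phi]) F i.
  apply/seteqP; split=> x; first by move/hE => [i phi_i Fx]; exists i.
  by case=> i phi_i Fx; apply/hE; exists i.
rewrite measure_fin_bigcup //; last by apply: sub_trivIset tF.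
by rewrite (@bigfs _ _ _ _ (index_enum I)) ?index_enum_uniq // => i _; rewrite mem_index_enum.
Qed.

(** One path represents both cylinders: [t] up to time [n], and [t] followed by [q] up to time
    [n.+1]. *)
Let glue n (t : {ffun 'I_n.+1 -> Q}) (q : Q) (j : nat) : Q :=
  if (j <= n)%N then t (inord j) else q.

(** Both events split into cylinders indexed by the first [n.+1] states, and appending [q]
    multiplies each weight by the same transition probability. *)
Lemma prob_coord_step n p q :
  P [set x | x n = p /\ x n.+1 = q] =
  ((ratr (trans A (w n) p q))%:E * P [set x | x n = p])%E.
Proof.
have triv m q' : (n <= m)%N -> trivIset setT
    (fun t : {ffun 'I_n.+1 -> Q} => cylinder A (glue t q') m : set (path_space A)).
  move=> le_nm; apply/trivIsetP => t t' _ _ /eqP neq; apply/seteqP; split=> x //.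
  case=> h h'; apply: neq; apply/ffunP => i.
  have lei : (i <= m)%N by apply: leq_trans le_nm; rewrite leq_ord.
  by have := h i lei; rewrite h' // /glue leq_ord inord_val.
rewrite (path_prob_fin_bigcup (phi := fun t : {ffun 'I_n.+1 -> Q} => t ord_max == p)
  (F := fun t => cylinder A (glue t q) n.+1)); first last.
- move=> x; split=> [[xp xq]|[t /eqP tp h]].
    exists [ffun i : 'I_n.+1 => x i]; first by rewrite ffunE; apply/eqP.
    move=> i; rewrite /glue leq_eqVlt ltnS => /orP[/eqP ->|lein].
      by rewrite ltnn.
    by rewrite lein ffunE inordK.
  split; first by rewrite h // /glue leqnn -tp; congr (t _); apply/val_inj; rewrite /= inordK.
  by rewrite h // /glue ltnn.
- exact: triv.
- by move=> t; exact: measurable_cylinder.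
rewrite (path_prob_fin_bigcup (E := [set x | x n = p]) (phi := fun t : {ffun 'I_n.+1 -> Q} => t ord_max == p)
  (F := fun t => cylinder A (glue t q) n)); first last.
- move=> x; split=> [xp|[t /eqP tp h]].
    exists [ffun i : 'I_n.+1 => x i]; first by rewrite ffunE; apply/eqP.
    by move=> i lein; rewrite /glue lein ffunE inordK.
  by rewrite /= h // /glue leqnn -tp; congr (t _); apply/val_inj; rewrite /= inordK.
- exact: triv.
- by move=> t; exact: measurable_cylinder.
rewrite ge0_sume_distrr; last by move=> t _; exact: measure_ge0.
apply: eq_bigr => t /eqP tp.
rewrite !path_probP -EFinM -rmorphM; congr (ratr _)%:E.
rewrite /prefix_weight big_ord_recr /= mulrA mulrC; congr (_ * (_ * _)).
  rewrite /glue leqnn ltnn -tp; congr (trans _ _ (t _) _).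
  by apply/val_inj; rewrite /= inordK.
Qed.

Lemma prob_coord n q : P [set x | x n = q] = (ratr (dist n q))%:E.
Proof.
elim: n q => [|n IHn] q.
  have -> : [set x | x 0%N = q] = cylinder A (fun=> q) 0.
    apply/seteqP; split=> x /=; last by move/(_ 0%N isT).
    by move=> xq i; rewrite leqn0 => /eqP ->.
  by rewrite path_probP /prefix_weight big_ord0 mulr1.
rewrite (path_prob_fin_bigcup (phi := xpredT)
  (F := fun p => [set x | x n = p /\ x n.+1 = q])); first last.
- move=> x; split=> [xq|[p _ [_ xq]]]; last exact: xq.
  by exists (x n).
- apply/trivIsetP => p p' _ _ /eqP neq; apply/seteqP; split=> x //.
  by case=> -[xp _] [xp' _]; apply: neq; rewrite -xp -xp'.
- move=> p; rewrite (_ : [set _ | _] = [set x | x n = p] `&` [set x | x n.+1 = q]) //.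
  by apply: measurableI; exact: measurable_coord.
rewrite /= rmorph_sum /= -sumEFin; apply: eq_bigr => p _.
by rewrite prob_coord_step IHn -EFinM rmorphM mulrC.
Qed.

(** Paths with a wrong first state or a transition of probability 0 form a countable union of null
    sets. Comparing probabilities is thereby reduced to combinatorics of the possible
    transitions. *)
Lemma prob_eq_as (E1 E2 : set (path_space A)) :
  measurable E1 -> measurable E2 ->
  (forall x : path_space A, x 0%N = init A ->
     (forall n, trans A (w n) (x n) (x n.+1) != 0) -> E1 x <-> E2 x) ->
  P E1 = P E2.
Proof.
move=> mE1 mE2 hE.
have null0 : P.-negligible [set x | x 0%N != init A].
  exists [set x | x 0%N \in ~: [set init A]%SET]; split.
  - exact: measurable_coord_in.
  - rewrite (path_prob_fin_bigcup (phi := fun q => q != init A)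
      (F := fun q => [set x | x 0%N = q])); first last.
    + move=> x /=; rewrite !inE; split=> [xi|[q qi xq]]; last by rewrite xq.
      by exists (x 0%N).
    + apply/trivIsetP => p p' _ _ /eqP neq; apply/seteqP; split=> x //.
      by case=> /= xp xp'; apply: neq; rewrite -xp -xp'.
    + by move=> q; exact: measurable_coord.
    by rewrite big1 // => q /negbTE qi; rewrite prob_coord /= qi rmorph0.
  - by move=> x /= xi; rewrite !inE.
have nullS n : P.-negligible [set x | trans A (w n) (x n) (x n.+1) = 0].
  exists (\bigcup_(u in [set u : Q * Q | trans A (w n) u.1 u.2 = 0])
            [set x | x n = u.1 /\ x n.+1 = u.2]).
  have mF (u : Q * Q) : measurable ([set x | x n = u.1 /\ x n.+1 = u.2] : set (path_space A)).
    rewrite (_ : [set _ | _] = [set x | x n = u.1] `&` [set x | x n.+1 = u.2]) //.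
    by apply: measurableI; exact: measurable_coord.
  split.
  - by apply: fin_bigcup_measurable => //; exact: finite_finset.
  - rewrite (path_prob_fin_bigcup (phi := fun u : Q * Q => trans A (w n) u.1 u.2 == 0)
      (F := fun u => [set x | x n = u.1 /\ x n.+1 = u.2])) //; first last.
    + move=> x; split=> [[u /= u0 xu]|[u /eqP u0 xu]]; first by exists u => //; apply/eqP.
      by exists u.
    + apply/trivIsetP => -[p q] [p' q'] _ _ /eqP neq; apply/seteqP; split=> x //=.
      by case=> -[-> ->] [e1 e2]; apply: neq; rewrite e1 e2.
    by rewrite big1 // => -[p q] /eqP /= u0; rewrite prob_coord_step u0 rmorph0 mul0e.
  - by move=> x /= x0; exists (x n, x n.+1).
have [N [mN N0 subN]] := negligibleU null0 (negligible_bigcup nullS).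
have good x : ~ N x -> E1 x <-> E2 x.
  move=> /(contra_not (@subN x)) notN; apply: hE.
    by apply/eqP; apply: contrapT => h; apply: notN; left; apply/negP.
  by move=> n; apply/eqP => h; apply: notN; right; exists n.
have half (F1 F2 : set (path_space A)) : measurable F1 -> measurable F2 ->
    (forall x, ~ N x -> F1 x -> F2 x) -> (P F1 <= P F2)%E.
  move=> mF1 mF2 sub12; rewrite -(measureU0 mF2 mN N0).
  apply: le_measure; rewrite ?inE //; first exact: measurableU.
  by move=> x F1x; case: (pselect (N x)) => Nx; [right | left; exact: sub12].
by apply/eqP; rewrite eq_le !half // => x /good[].
Qed.

End path_measure.

(** * Quadratic guard defects *)

Definition guards := seq (seq nat * seq nat).

Record letter := Letter { grd : guards; upd : nat -> seq nat }.

Definition passes (g : guards) (y : nat -> nat) : Prop :=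
  forall a, a \in g -> value a.1 y = value a.2 y.

(* pos_val g y - neg_val g y is the sum of the squared guard defects; it is   *)
(* kept as a difference of two quadratic forms with natural coefficients.     *)
Definition pos_val (g : guards) (y : nat -> nat) : nat :=
  \sum_(a <- g) (value a.1 y * value a.1 y + value a.2 y * value a.2 y).
Definition neg_val (g : guards) (y : nat -> nat) : nat :=
  \sum_(a <- g) 2 * (value a.1 y * value a.2 y).

Definition pos_coef (g : guards) (i j : nat) : nat :=
  \sum_(a <- g) (count_mem i a.1 * count_mem j a.1 +
                 count_mem i a.2 * count_mem j a.2).
Definition neg_coef (g : guards) (i j : nat) : nat :=
  \sum_(a <- g) 2 * (count_mem i a.1 * count_mem j a.2).

(** The inequality 2ab <= a^2 + b^2 with its equality case. The [?= iff] form lets equality cases be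
    combined over sums. *)
Lemma neg_pos_val g y : neg_val g y <= pos_val g y ?= iff
  all (fun a => value a.1 y == value a.2 y) g.
Proof.
rewrite /neg_val /pos_val; elim: g => [|a g IHg]; first by rewrite !big_nil.
rewrite !big_cons; apply: leqif_add IHg.
by have := nat_Cauchy (value a.1 y) (value a.2 y); rewrite -!mulnn.
Qed.

Lemma neg_pos_valP g y :
  reflect (passes g y) (all (fun a => value a.1 y == value a.2 y) g).
Proof.
apply: (iffP allP) => h a a_in; first by apply/eqP; exact: h.
by apply/eqP; exact: h.
Qed.

Definition bounded (D : nat) (e : seq nat) : bool := all (fun r => r < D) e.

Definition bounded_guards (D : nat) (g : guards) : bool :=
  all (fun a => bounded D a.1 && bounded D a.2) g.

Lemma value_count D e y : bounded D e ->
  value e y = \sum_(i < D) count_mem (val i) e * y i.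
Proof.
elim: e => [_|r e IHe] /=; first by rewrite big1.
case/andP=> lt_r /IHe; rewrite /value /= => ->.
rewrite (bigD1 (Ordinal lt_r)) //= [in RHS](bigD1 (Ordinal lt_r)) //= eqxx.
rewrite mulnDl mul1n -addnA; congr (_ + (_ + _)); apply: eq_bigr => i neq.
by rewrite (_ : r == i = false) // eq_sym; apply: negbTE.
Qed.

Lemma bilin_value D e e' y : bounded D e -> bounded D e' ->
  value e y * value e' y =
  \sum_(i < D) \sum_(j < D)
    y i * y j * (count_mem (val i) e * count_mem (val j) e').
Proof.
move=> be be'; rewrite (value_count y be) (value_count y be') big_distrlr /=.
by apply: eq_bigr => i _; apply: eq_bigr => j _; rewrite mulnACA mulnC.
Qed.

Lemma pos_val_coef D g y : bounded_guards D g ->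
  pos_val g y = \sum_(i < D) \sum_(j < D) y i * y j * pos_coef g i j.
Proof.
move=> /allP bg; rewrite /pos_val /pos_coef.
under [RHS]eq_bigr do under eq_bigr do rewrite big_distrr /=.
under [RHS]eq_bigr do rewrite exchange_big /=.
rewrite exchange_big /=; apply: eq_big_seq => a /bg /andP[b1 b2].
rewrite (bilin_value y b1 b1) (bilin_value y b2 b2) -big_split /=; apply: eq_bigr => i _.
by rewrite -big_split /=; apply: eq_bigr => j _; rewrite mulnDr.
Qed.

Lemma neg_val_coef D g y : bounded_guards D g ->
  neg_val g y = \sum_(i < D) \sum_(j < D) y i * y j * neg_coef g i j.
Proof.
move=> /allP bg; rewrite /neg_val /neg_coef.
under [RHS]eq_bigr do under eq_bigr do rewrite big_distrr /=.
under [RHS]eq_bigr do rewrite exchange_big /=.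
rewrite exchange_big /=; apply: eq_big_seq => a /bg /andP[b1 b2].
rewrite (bilin_value y b1 b2) big_distrr /=; apply: eq_bigr => i _.
by rewrite big_distrr /=; apply: eq_bigr => j _; rewrite mulnCA.
Qed.

Inductive mark := Init | Acc | Rej | Sink | Pos | Neg.

Definition mark_ord (m : mark) : 'I_6 :=
  match m with
  | Init => @Ordinal 6 0 isT | Acc => @Ordinal 6 1 isT
  | Rej => @Ordinal 6 2 isT | Sink => @Ordinal 6 3 isT
  | Pos => @Ordinal 6 4 isT | Neg => @Ordinal 6 5 isT
  end.
Definition ord_mark (i : 'I_6) : mark :=
  match val i with
  | 0 => Init | 1 => Acc | 2 => Rej | 3 => Sink | 4 => Pos | _ => Neg
  end.
Lemma mark_ordK : cancel mark_ord ord_mark.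
Proof. by case. Qed.
Lemma ord_markK : cancel ord_mark mark_ord.
Proof.
by case=> -[|[|[|[|[|[|]]]]]] // lt_i; apply/val_inj.
Qed.
HB.instance Definition _ := Finite.copy mark (can_type mark_ordK).

Lemma sum_mark (V : nmodType) (F : mark -> V) :
  (\sum_m F m = F Init + F Acc + F Rej + F Sink + F Pos + F Neg)%R.
Proof.
rewrite (reindex ord_mark) /=; last first.
  by exists mark_ord => m _; [exact: ord_markK | exact: mark_ordK].
by rewrite !big_ord_recr big_ord0 /= add0r.
Qed.

(** * The automaton of a machine *)

Definition bounded_letter (D : nat) (l : letter) : bool :=
  bounded_guards D (grd l) && all (fun r => bounded D (upd l r)) (iota 0 D).

Fixpoint store_at (lt : nat -> letter) (y : nat -> nat) (n : nat) : nat -> nat :=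
  if n is m.+1 then fun r => value (upd (lt m) r) (store_at lt y m) else y.

Definition pos_at (lt : nat -> letter) (y : nat -> nat) (n : nat) : nat :=
  \sum_(k < n) pos_val (grd (lt k)) (store_at lt y k).
Definition neg_at (lt : nat -> letter) (y : nat -> nat) (n : nat) : nat :=
  \sum_(k < n) neg_val (grd (lt k)) (store_at lt y k).

Section automaton.
Local Open Scope ring_scope.
Variables (d : nat) (ls : seq letter) (fin : guards).

(** The state [inl (i, j)] carries the product of coordinates [i] and [j] of the store. There are at
    least two coordinates, for the constant 1 and the input. *)
Definition state := ('I_d.+2 * 'I_d.+2 + mark)%type.

Definition letter0 : letter := Letter [::] (fun r => [:: r]).

(** On pairs this is the tensor square of the linear update of [l]; the columns [Pos] and [Neg] add
    the two halves of its defect to the accumulators. *)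
Definition weight (l : letter) (p q : state) : nat :=
  match p, q with
  | inl u, inl v =>
      (count_mem (val u.1) (upd l v.1) * count_mem (val u.2) (upd l v.2))%N
  | inl u, inr Pos => pos_coef (grd l) u.1 u.2
  | inl u, inr Neg => neg_coef (grd l) u.1 u.2
  | inr Pos, inr Pos => 1%N
  | inr Neg, inr Neg => 1%N
  | _, _ => 0%N
  end.

(** One divisor serves all rows of a letter, so that the whole vector is scaled by a common factor;
    the successor keeps it positive. *)
Definition norm (l : letter) : nat := (\sum_p \sum_q weight l p q).+1.

Definition pos_out (p : state) : nat :=
  match p with
  | inl u => pos_coef fin u.1 u.2 | inr Pos => 1%N | _ => 0%N
  end.
Definition neg_out (p : state) : nat :=
  match p with
  | inl u => neg_coef fin u.1 u.2 | inr Neg => 1%N | _ => 0%N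
  end.

Definition norm_out : nat := (\sum_p (pos_out p + neg_out p)).+1.

(** Equal to 1/2 + ([pos_out p] - [neg_out p]) / (2 [norm_out]); in particular [Sink] accepts at
    rate exactly 1/2. *)
Definition accept_rate (p : state) : rat :=
  (norm_out%:R + (pos_out p)%:R - (neg_out p)%:R) / (2 * norm_out%:R).

Definition init_store (c i : nat) : nat :=
  match i with 0%N => 1%N | 1%N => c | _ => 0%N end.

Definition init_row (c : nat) (q : state) : rat :=
  if q is inl u then
    (init_store c u.1 * init_store c u.2)%:R / ((1 + c) ^ 2)%:R
  else 0.

(* Letter 0 starts the computation, letter 1 ends it, and letter l + 2 runs   *)
(* the l-th machine letter. Rows are substochastic; the missing mass goes to  *)
(* the state leak.                                                            *)
Definition row (c a : nat) (p q : state) : rat :=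
  match p, a with
  | inr (Acc | Rej), _ => 0
  | inr Init, 0%N => init_row c q
  | inr Init, _ => 0
  | _, 0%N => 0
  | _, 1%N => if q is inr Acc then accept_rate p else 0
  | _, l.+2 => (weight (nth letter0 ls l) p q)%:R / (norm (nth letter0 ls l))%:R
  end.

Definition leak (a : nat) (p : state) : state :=
  match p, a with
  | inr Acc, _ => inr Acc
  | inr (Rej | Init), _ => inr Rej
  | _, (0%N | 1%N) => inr Rej
  | _, _ => inr Sink
  end.

Definition step (c a : nat) (p q : state) : rat :=
  row c a p q + (q == leak a p)%:R * (1 - \sum_q' row c a p q').

Lemma sum_state (V : nmodType) (F : state -> V) :
  \sum_p F p = \sum_i \sum_j F (inl (i, j)) + \sum_m F (inr m).
Proof.
rewrite big_sumType /=; congr (_ + _); rewrite pair_bigA /=.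
by apply: eq_bigr => -[].
Qed.

Lemma norm_gt0 l : 0 < (norm l)%:R :> rat. Proof. by rewrite ltr0n. Qed.

Lemma out_le_norm p : (pos_out p + neg_out p <= norm_out)%N.
Proof. by rewrite /norm_out (bigD1 p) //= leqW ?leq_addr. Qed.

Lemma accept_rate_itv p : 0 <= accept_rate p <= 1.
Proof.
have n0 : 0 < 2 * norm_out%:R :> rat by rewrite mulr_gt0 ?ltr0n.
have := out_le_norm p; rewrite -(ler_nat rat) natrD => le_out.
have pos0 : 0 <= (pos_out p)%:R :> rat by rewrite ler0n.
have neg0 : 0 <= (neg_out p)%:R :> rat by rewrite ler0n.
by rewrite /accept_rate divr_ge0 ?ler_pdivrMr ?(ltW n0) //=; lra.
Qed.

Lemma init_row_sum c : \sum_q init_row c q = 1.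
Proof.
rewrite sum_state [X in _ + X]big1 // addr0 /=.
under eq_bigr do rewrite -mulr_suml -natr_sum.
rewrite -mulr_suml -natr_sum.
have -> : (\sum_(i < d.+2) \sum_(j < d.+2) init_store c i * init_store c j =
    (1 + c) ^ 2)%N.
  rewrite -big_distrlr /= -mulnn !big_ord_recl /=.
  by rewrite big1 ?addn0.
by rewrite divff // pnatr_eq0 expn_eq0.
Qed.

Lemma row_ge0 c a p q : 0 <= row c a p q.
Proof.
have [acc0 _] := andP (accept_rate_itv p).
case: p acc0 => [u|[]] acc0 //=; case: a => [|[|a]] //=.
all: try (by rewrite divr_ge0 ?ler0n).
all: by case: q => [v|[]] //=; rewrite divr_ge0 ?ler0n.
Qed.

Lemma row_sum_le1 c a p : \sum_q row c a p q <= 1.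
Proof.
have z0 : \sum_(q : state) 0 <= 1 :> rat by rewrite big1.
have out : \sum_(q : state) (if q is inr Acc then accept_rate p else 0) <= 1.
  rewrite sum_state big1 ?add0r; last by move=> i _; rewrite big1.
  by rewrite sum_mark !addr0 !add0r; case/andP: (accept_rate_itv p).
have run l : \sum_q (weight l p q)%:R / (norm l)%:R <= 1 :> rat.
  rewrite -mulr_suml ler_pdivrMr ?norm_gt0 // mul1r -natr_sum ler_nat.
  by apply: leqW; rewrite [leqRHS](bigD1 p) //= leq_addr.
case: p out run => [u|[]] out run; case: a => [|[|a]] //=.
all: by [exact: run | rewrite init_row_sum].
Qed.

Lemma step_ge0 c a p q : 0 <= step c a p q.
Proof.
by rewrite addr_ge0 ?row_ge0 // mulr_ge0 ?ler0n // subr_ge0 row_sum_le1.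
Qed.

Lemma step_sum1 c a p : \sum_q step c a p q = 1.
Proof.
have leak1 : \sum_q (q == leak a p)%:R = 1 :> rat.
  by rewrite (bigD1 (leak a p)) //= eqxx big1 ?addr0 // => q /negbTE ->.
by rewrite big_split /= -[X in _ + X]mulr_suml leak1 mul1r subrKC.
Qed.

Definition model (c : nat) : pautomaton state 'I_(size ls).+2 :=
  PAutomaton (inr Init) (fun a => step_ge0 c (val a))
    (fun a => step_sum1 c (val a)).

(** * Numbering of the states *)

Let o1 : 'I_d.+2 := lift ord0 ord0.

(** These states get fixed positions: only the first row of the start letter depends on [c], and
    only in the columns of the four pairs. The dependence on [c] thus stays at the front of the
    transition table, and the two absorbing states sit at known indices. *)
Definition first_states : seq state :=
  [:: inr Init; inl (ord0, ord0); inl (ord0, o1); inl (o1, ord0); inl (o1, o1);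
      inr Acc; inr Rej].
Definition other_states : seq state :=
  [seq t <- enum {: state} | t \notin first_states].
Definition states : seq state := first_states ++ other_states.

Lemma states_uniq : uniq states.
Proof.
rewrite cat_uniq filter_uniq ?enum_uniq // andbT; apply/andP; split; first by [].
by apply/hasPn => t; rewrite mem_filter => /andP[].
Qed.

Lemma mem_states t : t \in states.
Proof.
by rewrite mem_cat mem_filter mem_enum andbT orbN.
Qed.

Definition nothers : nat := size other_states.

Definition decode (q : 'I_nothers.+4.+3) : state := nth (inr Init) states q.

Lemma map_decode (V : Type) (F : state -> V) :
  [seq F (decode q) | q <- enum 'I_nothers.+4.+3] = map F states.
Proof.
have -> : states = [seq decode q | q <- enum 'I_nothers.+4.+3].
  by rewrite -[LHS](mkseq_nth (inr Init)) /mkseq -[size _]/(nothers.+4.+3)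
    -val_enum_ord -map_comp.
by rewrite -map_comp.
Qed.

Lemma sum_decode (V : nmodType) (F : state -> V) :
  \sum_q F (decode q) = \sum_t F t.
Proof.
rewrite -big_enum -(big_map (fun q => F (decode q)) xpredT id) map_decode big_map.
rewrite -[RHS]big_enum; apply: perm_big.
apply: uniq_perm; [exact: states_uniq | exact: enum_uniq|].
by move=> t; rewrite mem_states mem_enum.
Qed.

Lemma decode_inj : injective decode.
Proof.
by move=> q q' /eqP; rewrite nth_uniq ?states_uniq ?ltn_ord // => /eqP/val_inj.
Qed.

Definition encoded (c : nat) : pautomaton 'I_nothers.+4.+3 'I_(size ls).+2.
Proof.
refine (@PAutomaton _ _ ord0 (fun a p q => step c (val a) (decode p) (decode q)) _ _).
  by move=> a p q; exact: step_ge0.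
by move=> a p; rewrite (sum_decode (step c (val a) (decode p))) step_sum1.
Defined.

Lemma dist_encoded c w n q :
  dist (encoded c) w n q = dist (model c) w n (decode q).
Proof.
elim: n q => [|n IHn] q /=.
  by rewrite -(inj_eq decode_inj).
rewrite -sum_decode; apply: eq_bigr => p _.
by rewrite IHn.
Qed.

Local Arguments dist : simpl never.

Lemma step_live c l (p q : state) : p \notin [:: inr Init; inr Acc; inr Rej] ->
  q != inr Sink ->
  step c l.+2 p q =
  (weight (nth letter0 ls l) p q)%:R / (norm (nth letter0 ls l))%:R.
Proof.
move=> live /negbTE neq; rewrite /step (_ : q == leak l.+2 p = false).
  by rewrite mul0r addr0; case: p live => [u|[]].
by case: p live => [u|[]].
Qed.

(** * Possible paths and events decided by absorption *)

Section events.
Variables (R : realType) (c : nat) (w : nat -> 'I_(size ls).+2).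

Local Notation A := (encoded c).
Local Notation P := (path_prob R A w).

Definition live (t : state) : bool := t \notin [:: inr Init; inr Acc; inr Rej].

Definition acc_state : 'I_nothers.+4.+3 := Ordinal (isT : (5 < nothers.+4.+3)%N).

Lemma step_absorbing a (m : mark) q : m \in [:: Acc; Rej] ->
  step c a (inr m) q = (q == inr m)%:R.
Proof.
by case: m => //; rewrite /step /= => _; rewrite big1 // subr0 mulr1 add0r.
Qed.

Lemma step_init a q : step c a.+1 (inr Init) q = (q == inr Rej)%:R.
Proof. by rewrite /step /= big1 // subr0 mulr1 add0r. Qed.

Lemma step_start q : step c 0 (inr Init) q = init_row c q.
Proof. by rewrite /step /= init_row_sum subrr mulr0 addr0. Qed.

Lemma step_restart p q : live p -> step c 0 p q = (q == inr Rej)%:R.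
Proof.
by case: p => [u|[]] // _; rewrite /step /= big1 // subr0 mulr1 add0r.
Qed.

Lemma step_stop p q : live p -> step c 1 p q != 0 -> q = inr Acc \/ q = inr Rej.
Proof.
move=> lp; have -> : step c 1 p q = (if q is inr Acc then accept_rate p else 0)
    + (q == inr Rej)%:R * (1 - \sum_q' row c 1 p q').
  by case: p lp => [u|[]].
have [->|neq] := eqVneq q (inr Rej); first by right.
by case: q neq => [u|[]]; rewrite ?mul0r ?addr0 ?eqxx //; left.
Qed.

Lemma step_run l p q : live p -> step c l.+2 p q != 0 -> live q.
Proof.
move=> lp; case: q => [u|[]] //=; rewrite step_live //.
all: by case: p lp => [v|[]] // _; rewrite mul0r eqxx.
Qed.

Section good_path.
Variable x : path_space A.
Hypothesis x0 : x 0%N = init A.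
Hypothesis xS : forall n, trans A (w n) (x n) (x n.+1) != 0.

Local Notation z n := (decode (x n)).

Lemma path_step n : step c (w n) (z n) (z n.+1) != 0. Proof. exact: xS. Qed.

Lemma path_absorbing (m : mark) n k : m \in [:: Acc; Rej] -> z n = inr m ->
  (n <= k)%N -> z k = inr m.
Proof.
move=> mAR zn /subnK <-; elim: (k - n)%N => [//|j IHj].
have := path_step (j + n); rewrite IHj step_absorbing //.
by rewrite pnatr_eq0 eqb0 negbK => /eqP.
Qed.

Lemma path_not_both n k : z n = inr Acc -> z k = inr Rej -> False.
Proof.
move=> zn zk; have := path_absorbing (isT : Acc \in [:: Acc; Rej]) zn (leq_maxl n k).
by rewrite (path_absorbing (isT : Rej \in [:: Acc; Rej]) zk (leq_maxr n k)).
Qed.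

Lemma path_bad_start : val (w 0%N) != 0%N -> z 1%N = inr Rej.
Proof.
have := path_step 0; rewrite x0 (_ : decode (init A) = inr Init) //.
rewrite -[nat_of_ord (w 0%N)]/(val (w 0%N)); case: (val (w 0%N)) => // a.
rewrite step_init.
by rewrite pnatr_eq0 eqb0 negbK => /eqP.
Qed.

Lemma path_live n : val (w 0%N) = 0%N -> (forall k, (0 < k <= n)%N -> (2 <= w k)%N) ->
  live (z n.+1).
Proof.
move=> w0; elim: n => [_|n IHn wn].
  have := path_step 0; rewrite x0 (_ : decode (init A) = inr Init) // [nat_of_ord _]w0.
  by rewrite step_start; case: (z 1%N) => [u|m] //=; rewrite eqxx.
have live_n : live (z n.+1).
  by apply: IHn => k /andP[k0 kn]; apply: wn; rewrite k0 leqW.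
have := path_step n.+1; have := wn n.+1; rewrite leqnn => /(_ isT).
case: (nat_of_ord (w n.+1)) => [|[|l]] // _; exact: step_run.
Qed.

End good_path.

(** The common shape of the two acceptance conditions; [b] is the truth value on paths that are
    never absorbed, [true] for safety and [false] for reachability. *)
Variables (E : set (path_space A)) (b : bool).
Hypothesis mE : measurable E.
Hypothesis E_rej : forall x : path_space A,
  (exists n, decode (x n) = inr Rej) -> (forall n, decode (x n) != inr Acc) -> ~ E x.
Hypothesis E_acc : forall x : path_space A,
  (exists n, decode (x n) = inr Acc) -> (forall n, decode (x n) != inr Rej) -> E x.
Hypothesis E_never : forall x : path_space A,
  (forall n, decode (x n) != inr Acc) -> (forall n, decode (x n) != inr Rej) -> E x <-> b.

(** A word that fails to begin with the start letter, or repeats it before stopping, is surely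
    rejected; a word that never stops has probability 0 or 1 according to [b]. What remains is a
    start, machine letters and a stop, after which every path is absorbed. *)
Lemma prob_event : P E = (ratr (1 / 2))%:E <->
  exists n, [/\ val (w 0%N) = 0%N, forall k, (0 < k <= n)%N -> (2 <= w k)%N,
    val (w n.+1) = 1%N & dist (model c) w n.+2 (inr Acc) = 1 / 2].
Proof.
have PE_acc n : val (w 0%N) = 0%N -> (forall k, (0 < k <= n)%N -> (2 <= w k)%N) ->
    val (w n.+1) = 1%N -> P E = (ratr (dist (model c) w n.+2 (inr Acc)))%:E.
  move=> w0 wn w1; rewrite (_ : inr Acc = decode acc_state) // -dist_encoded.
  rewrite -prob_coord; apply: prob_eq_as => //; first exact: measurable_coord.
  move=> x x0 xS; have := path_step xS n.+1; rewrite [nat_of_ord _]w1.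
  move/(step_stop (path_live x0 xS w0 wn)) => [zA|zR].
    split=> _; first by apply: decode_inj; rewrite zA.
    apply: E_acc; first by exists n.+2.
    by move=> k; apply/eqP => zk; apply: (path_not_both xS zA zk).
  split=> [Ex|xA]; last by rewrite xA in zR.
  exfalso; apply: (E_rej _ _ Ex); first by exists n.+2.
  by move=> k; apply/eqP => zk; apply: (path_not_both xS zk zR).
split=> [PE|[n [w0 wn w1 muA]]]; last by rewrite (PE_acc n) // muA.
have PE_no : (forall x : path_space A, x 0%N = init A ->
    (forall n, trans A (w n) (x n) (x n.+1) != 0) ->
    exists n, decode (x n) = inr Rej) -> False.
  move=> rej; suff P0 : P E = 0%:E.
    by move: PE; rewrite P0 => -[] /esym/eqP; rewrite fmorph_eq0.
  have <- : P set0 = 0%:E by exact: measure0.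
  apply: prob_eq_as => // x x0 xS; split=> // Ex.
  have [k zk] := rej x x0 xS.
  apply: (E_rej _ _ Ex); first by exists k.
  by move=> j; apply/eqP => zj; apply: (path_not_both xS zj zk).
have [w0|w0] := eqVneq (val (w 0%N)) 0%N; last first.
  case: PE_no => x x0 xS; exists 1%N; exact: path_bad_start.
have [[n wn]|never] := pselect (exists n, (w n.+1 < 2)%N); last first.
  have w2 k : (0 < k)%N -> (2 <= w k)%N.
    by case: k => // k _; rewrite leqNgt; apply/negP => h; apply: never; exists k.
  have lv x : x 0%N = init A -> (forall n, trans A (w n) (x n) (x n.+1) != 0) ->
      forall n, decode (x n) != inr Acc /\ decode (x n) != inr Rej.
    move=> x0 xS [|n]; first by rewrite x0.
    have := path_live x0 xS w0 (fun k (h : (0 < k <= n)%N) => w2 k (proj1 (andP h))).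
    by rewrite /live !inE !negb_or => /and3P[].
  exfalso; suff Pb : P E = (b%:R)%:E.
    move: PE; rewrite Pb => -[] /eqP; rewrite -[b%:R](rmorph_nat ratr) (inj_eq (fmorph_inj _)).
    by case: (b).
  have -> : (b%:R)%:E = P (if b then setT else set0).
    by case: (b); rewrite ?probability_setT ?measure0.
  apply: prob_eq_as => //; first by case: (b).
  move=> x x0 xS; rewrite E_never; [by case: (b)| |] => n; by case: (lv x x0 xS n).
have exP : exists n, (w n.+1 < 2)%N by exists n.
case: (ex_minnP exP) => {}n {}wn minn.
have w2 k : (0 < k <= n)%N -> (2 <= w k)%N.
  case: k => // k /= kn; rewrite leqNgt; apply/negP => /minn; lia.
have [w1|w1] := eqVneq (val (w n.+1)) 0%N.
  case: PE_no => x x0 xS; exists n.+2; have := path_step xS n.+1.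
  rewrite [nat_of_ord _]w1 step_restart; last exact: path_live.
  by rewrite pnatr_eq0 eqb0 negbK => /eqP.
have {}w1 : val (w n.+1) = 1%N by move: wn w1; rewrite /=; lia.
exists n; split=> //; move: PE; rewrite (PE_acc n) // => -[] /eqP.
by rewrite (inj_eq (fmorph_inj _)) => /eqP.
Qed.

End events.

Hypothesis ls_bounded : all (bounded_letter d.+2) ls.
Hypothesis fin_bounded : bounded_guards d.+2 fin.

(** * Distribution along a computation *)

Section run.
Variables (c : nat) (w : nat -> 'I_(size ls).+2).
Hypothesis w0 : val (w 0%N) = 0%N.

Local Notation mu := (dist (model c) w).

(** The shift by one position skips the start letter, and the subtraction of 2 skips the codes of
    start and stop. *)
Definition run_letter (k : nat) : letter := nth letter0 ls (w k.+1 - 2).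

Local Notation y := (store_at run_letter (init_store c)).

Lemma dist_model_S n q : mu n.+1 q = \sum_p mu n p * step c (w n) p q.
Proof. by []. Qed.

(** The distribution is, up to one positive scalar, the tensor square of the current store with its
    accumulated defects; the rest of the mass lies in [Sink]. *)
Lemma dist_run n : (forall k, (0 < k <= n)%N -> (2 <= w k)%N) ->
  exists s : rat,
    [/\ 0 < s,
        forall u, mu n.+1 (inl u) = s * (y n u.1 * y n u.2)%:R,
        mu n.+1 (inr Pos) = s * (pos_at run_letter (init_store c) n)%:R,
        mu n.+1 (inr Neg) = s * (neg_at run_letter (init_store c) n)%:R &
        [/\ mu n.+1 (inr Init) = 0, mu n.+1 (inr Acc) = 0 &
            mu n.+1 (inr Rej) = 0]].
Proof.
elim: n => [|n IHn] wn.
  have mu1 q : mu 1 q = step c 0 (inr Init) q.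
    rewrite dist_model_S (bigD1 (inr Init)) //= mul1r [nat_of_ord (w 0%N)]w0.
    by rewrite big1 ?addr0 // => p /negbTE neq; rewrite /dist /= neq mul0r.
  have step0 q : step c 0 (inr Init) q = init_row c q.
    by rewrite /step /= init_row_sum subrr mulr0 addr0.
  exists ((1 + c) ^ 2)%:R^-1; rewrite /pos_at /neg_at !big_ord0 !mulr0.
  split; [by rewrite invr_gt0 ltr0n expn_gt0| |by rewrite mu1 step0..|].
    by move=> u; rewrite mu1 step0 /= mulrC.
  by rewrite !mu1 !step0.
have [|s [s0 mu_inl muP muN [muI muA muR]]] := IHn.
  by move=> k /andP[k0 kn]; apply: wn; rewrite k0 leqW.
have w2 : (2 <= w n.+1)%N by apply: wn; rewrite leqnn.
set l := (w n.+1 - 2)%N.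
have wE : val (w n.+1) = l.+2 by move: w2; rewrite /l /=; lia.
have lt_l : (l < size ls)%N by have := ltn_ord (w n.+1); rewrite [nat_of_ord _]wE !ltnS.
have rl : nth letter0 ls l = run_letter n by [].
have /andP[bg /allP bu] : bounded_letter d.+2 (run_letter n).
  by rewrite -rl; apply: (all_nthP letter0 ls_bounded).
have muS (q : state) : q != inr Sink -> mu n.+2 q = (norm (run_letter n))%:R^-1 *
    (\sum_(i < d.+2) \sum_(j < d.+2) s * (y n i * y n j * weight (run_letter n) (inl (i, j)) q)%:R +
     (mu n.+1 (inr Sink) * (weight (run_letter n) (inr Sink) q)%:R +
      s * (pos_at run_letter (init_store c) n * weight (run_letter n) (inr Pos) q)%:R +
      s * (neg_at run_letter (init_store c) n * weight (run_letter n) (inr Neg) q)%:R)).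
  move=> neq; rewrite dist_model_S sum_state sum_mark.
  rewrite muI muA muR !mul0r !add0r [w n.+1 : nat]wE.
  have nz : (norm (run_letter n))%:R != 0 :> rat by rewrite gt_eqF ?norm_gt0.
  rewrite [RHS]mulrDr; congr (_ + _); last first.
    by rewrite muP muN !step_live // rl !natrM; field.
  rewrite mulr_sumr; apply: eq_bigr => i _; rewrite mulr_sumr.
  apply: eq_bigr => j _; rewrite mu_inl step_live // rl [in RHS]natrM.
  by rewrite [RHS]mulrC !mulrA.
exists (s / (norm (run_letter n))%:R); split.
- by rewrite divr_gt0 ?norm_gt0.
- move=> [i j]; rewrite muS // !muln0 !mulr0 !addr0 [LHS]mulrC [RHS]mulrAC.
  congr (_ * _).
  under eq_bigr do rewrite -mulr_sumr -natr_sum.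
  rewrite -mulr_sumr -natr_sum; congr (_ * _%:R).
  have bur r : (r < d.+2)%N -> bounded d.+2 (upd (run_letter n) r).
    by move=> ltr; apply: bu; rewrite mem_iota.
  by rewrite /= -bilin_value //; apply: bur.
- rewrite muS // muln0 muln1 !mulr0 addr0 add0r.
  under eq_bigr do rewrite -mulr_sumr -natr_sum.
  rewrite -mulr_sumr -natr_sum -(pos_val_coef _ bg).
  rewrite /pos_at big_ord_recr /= natrD; ring.
- rewrite muS // muln0 muln1 !mulr0 !add0r.
  under eq_bigr do rewrite -mulr_sumr -natr_sum.
  rewrite -mulr_sumr -natr_sum -(neg_val_coef _ bg).
  rewrite /neg_at big_ord_recr /= natrD; ring.
- by split; rewrite muS // !muln0 !mulr0 !addr0 big1 ?mulr0 // => i _;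
    rewrite big1 // => j _; rewrite muln0 mulr0.
Qed.

(** Before the stop letter all mass is on states accepting at rate 1/2 plus a correction. The
    corrections add up to a positive multiple of [gap], the total squared defect including that of
    the final guards. *)
Lemma dist_stop n : (forall k, (0 < k <= n)%N -> (2 <= w k)%N) ->
  val (w n.+1) = 1%N ->
  mu n.+2 (inr Acc) = 1 / 2 <->
  (forall k, (k < n)%N -> passes (grd (run_letter k)) (y k)) /\ passes fin (y n).
Proof.
move=> wn wE; have [s [s0 mu_inl muP muN [muI muA muR]]] := dist_run wn.
set m := norm_out.
have m0 : 0 < m%:R :> rat by rewrite ltr0n.
pose gap := ((pos_at run_letter (init_store c) n + pos_val fin (y n))%:R -
  (neg_at run_letter (init_store c) n + neg_val fin (y n))%:R : rat).
have muacc : mu n.+2 (inr Acc) = 1 / 2 + s / (2 * m%:R) * gap.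
  have stepA (p : state) : p \notin [:: inr Init; inr Acc; inr Rej] ->
      step c 1 p (inr Acc) = 1 / 2 + ((pos_out p)%:R - (neg_out p)%:R) / (2 * m%:R).
    move=> live; have -> : step c 1 p (inr Acc) = accept_rate p.
      by case: p live => [u|[]] // _; rewrite /step /= mul0r addr0.
    by rewrite /accept_rate -/m; field; rewrite gt_eqF.
  have := dist_sum1 (model c) w n.+1; rewrite sum_state sum_mark.
  rewrite muI muA muR !add0r => total.
  rewrite dist_model_S sum_state sum_mark.
  rewrite muI muA muR !mul0r !add0r [w n.+1 : nat]wE.
  have inner : \sum_(i < d.+2) \sum_(j < d.+2)
        mu n.+1 (inl (i, j)) * step c 1 (inl (i, j)) (inr Acc) =
      1 / 2 * (\sum_(i < d.+2) \sum_(j < d.+2) mu n.+1 (inl (i, j))) +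
      s / (2 * m%:R) * ((pos_val fin (y n))%:R - (neg_val fin (y n))%:R).
    rewrite (pos_val_coef _ fin_bounded) (neg_val_coef _ fin_bounded).
    rewrite !natr_sum -sumrB !mulr_sumr -big_split; apply: eq_bigr => i _ /=.
    rewrite !natr_sum -sumrB !mulr_sumr -big_split; apply: eq_bigr => j _ /=.
    by rewrite stepA // mu_inl !natrM /=; field; rewrite gt_eqF.
  have -> : s / (2 * m%:R) * gap = s / (2 * m%:R) *
      ((pos_val fin (y n))%:R - (neg_val fin (y n))%:R +
       ((pos_at run_letter (init_store c) n)%:R -
        (neg_at run_letter (init_store c) n)%:R)).
    by rewrite /gap !natrD; congr (_ * _); ring.
  rewrite inner; move: total; set big := \sum_i _ => total.
  (* Total mass 1 is used here, so the unknown mass of [Sink] cancels. *)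
  have -> : big = 1 - (mu n.+1 (inr Sink) + mu n.+1 (inr Pos) + mu n.+1 (inr Neg)).
    by rewrite -total; ring.
  rewrite !stepA // muP muN /=.
  by field; rewrite gt_eqF.
have le_at : (neg_at run_letter (init_store c) n <= pos_at run_letter (init_store c) n ?= iff
    [forall k : 'I_n, all (fun a => value a.1 (y k) == value a.2 (y k)) (grd (run_letter k))])%N.
  apply: leqif_sum => k _; exact: neg_pos_val.
have [_ eq_all] := leqif_add le_at (neg_pos_val fin (y n)).
have -> : (mu n.+2 (inr Acc) = 1 / 2) <-> gap = 0.
  rewrite muacc; split=> [|->]; last by rewrite mulr0 addr0.
  move/eqP; rewrite -subr_eq0 addrC addKr mulf_eq0 => /orP[|/eqP //].
  by rewrite gt_eqF // divr_gt0 // mulr_gt0.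
have -> : gap = 0 <-> (neg_at run_letter (init_store c) n + neg_val fin (y n) ==
   pos_at run_letter (init_store c) n + pos_val fin (y n))%N.
  rewrite /gap; split=> [/eqP|/eqP ->]; last by rewrite subrr.
  by rewrite subr_eq0 eqr_nat eq_sym.
rewrite eq_all; split.
  case/andP=> /forallP h /neg_pos_valP ?; split=> // k ltk.
  by apply/neg_pos_valP; exact: (h (Ordinal ltk)).
case=> h /neg_pos_valP ->; rewrite andbT; apply/forallP => k.
by apply/neg_pos_valP; apply: h.
Qed.

End run.
End automaton.

(** * Machines of control flow graphs *)

Fixpoint keeps_constant (p : prog) : bool :=
  match p with
  | Do o => 0 < tgt o
  | Then p q => keeps_constant p && keeps_constant q
  | Loop p => keeps_constant p
  end.

Lemma compile_keeps_constant f args out n :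
  0 < out -> 0 < n -> keeps_constant (compile f args out n).
Proof.
elim/murec_nested_ind: f args out n => [|||f gs IHf IHgs|f g IHf IHg|f IHf].
- by [].
- by case.
- by move=> i args out n out0 _ /=; case: ifP.
- move=> args out n out0 n0 /=; apply/andP; split; last by apply: IHf => //; lia.
  rewrite -/(compile_all args (n + size gs) gs n).
  have : 0 < n + size gs by lia.
  move: (n + size gs) => m m0; elim: gs n n0 IHgs => [|g gs IH] n n0 IHgs //=.
  by rewrite (IHgs 0) //= IH // => i; apply: (IHgs i.+1).
- by move=> [|a args] out n out0 n0 //=; rewrite n0 out0 IHf ?IHg.
- by move=> args out n out0 n0 /=; rewrite n0 out0 !IHf.
Qed.

Lemma edges_keep_constant p s t n : keeps_constant p ->
  all (fun e : edge => 0 < tgt e.1.2) (edges p s t n).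
Proof.
elim: p s t n => [a|p IHp q IHq|p IHp] s t n /=; first by rewrite andbT.
- by case/andP=> hp hq; rewrite all_cat IHp ?IHq.
- exact: IHp.
Qed.

Section machine.
(* k is the number of registers; coordinate k holds the program counter. *)
Variable k : nat.
Hypothesis k2 : 1 < k.

Definition bounded_op (o : op) : bool :=
  [&& bounded k (lhs o), bounded k (rhs o), bounded k (src o) & tgt o < k].

(** The program counter is tested and set as an ordinary coordinate; a label [l] is the linear form
    made of [l] copies of the constant register 0. *)
Definition edge_letter (e : edge) : letter :=
  Letter [:: ([:: k], nseq e.1.1 0); (lhs e.1.2, rhs e.1.2)]
    (fun r => if r == k then nseq e.2 0
              else if r == tgt e.1.2 then src e.1.2 else [:: r]).

Definition halted (t out : nat) : guards := [:: ([:: k], nseq t 0); ([:: out], [::])].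

Definition configuration (l : nat) (x : nat -> nat) (r : nat) : nat :=
  if r == k then l else x r.

Lemma value_configuration e l x :
  bounded k e -> value e (configuration l x) = value e x.
Proof.
move=> /allP be; congr sumn; apply/eq_in_map => r /be ltr.
by rewrite /configuration ltn_eqF.
Qed.

Lemma value_constant n l x : x 0 = 1 -> value (nseq n 0) (configuration l x) = n.
Proof.
move=> x0; rewrite /value map_nseq sumn_nseq /configuration.
by case: eqP => [k0|_]; [move: k2; rewrite -k0 | rewrite x0 mul1n].
Qed.

Lemma value_pc l x : value [:: k] (configuration l x) = l.
Proof. by rewrite /value /= addn0 /configuration eqxx. Qed.

Lemma edge_letter_passes s o t l x : bounded_op o -> x 0 = 1 ->
  passes (grd (edge_letter (s, o, t))) (configuration l x) <->
  l = s /\ enabled o x.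
Proof.
case/and4P=> b1 b2 _ _ x0; rewrite /enabled; split.
  move=> h; split.
    by have := h _ (mem_head _ _); rewrite /= value_pc value_constant.
  have := h (lhs o, rhs o); rewrite !inE eqxx orbT => /(_ isT) /=.
  by rewrite !value_configuration.
case=> ls en a; rewrite !inE => /orP[/eqP ->|/eqP ->] /=.
  by rewrite value_pc value_constant.
by rewrite !value_configuration.
Qed.

Lemma halted_passes t out l x : out < k -> x 0 = 1 ->
  passes (halted t out) (configuration l x) <-> l = t /\ x out = 0.
Proof.
move=> lt_out x0; split.
  move=> h; split.
    by have := h _ (mem_head _ _); rewrite /= value_pc value_constant.
  have := h ([:: out], [::]); rewrite !inE eqxx orbT => /(_ isT).
  by rewrite /value /= addn0 /configuration ltn_eqF.
case=> lt xout a; rewrite !inE => /orP[/eqP ->|/eqP ->] /=.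
  by rewrite value_pc value_constant.
by rewrite /value /= addn0 /configuration ltn_eqF.
Qed.

Lemma edge_letter_update s o t l x : bounded_op o -> x 0 = 1 ->
  (fun r => value (upd (edge_letter (s, o, t)) r) (configuration l x)) =
  configuration t (update o x).
Proof.
case/and4P=> _ _ b3 b4 x0; apply/funext => r /=.
rewrite {2}/configuration; case: eqP => [_|/eqP neq]; first exact: value_constant.
rewrite /update; case: eqP => _; first exact: value_configuration.
by rewrite /value /= addn0 /configuration (negbTE neq).
Qed.

Lemma edge_letter_bounded e : bounded_op e.1.2 -> bounded_letter k.+1 (edge_letter e).
Proof.
have weaken a : bounded k a -> bounded k.+1 a by apply: sub_all => r; lia.
have const n : bounded k.+1 (nseq n 0) by rewrite /bounded all_nseq orbT.
case/and4P=> b1 b2 b3 b4; apply/andP; split.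
  by rewrite /= const !weaken //= ltnSn.
apply/allP => r; rewrite mem_iota /= => ltr.
case: eqP => _ //; case: eqP => _; first exact: weaken.
by rewrite /bounded /= andbT.
Qed.

Lemma halted_bounded t out : out < k -> bounded_guards k.+1 (halted t out).
Proof.
move=> lt_out; rewrite /= /bounded all_nseq /= ltnSn orbT /=; lia.
Qed.

Variables (es : seq edge) (halt out : nat).
Hypothesis es_bounded : all (fun e => bounded_op e.1.2) es.
Hypothesis es_constant : all (fun e : edge => 0 < tgt e.1.2) es.
Hypothesis out_lt : out < k.

Section word.
Variables (lt : nat -> letter) (w : nat -> edge) (l : nat) (x : nat -> nat).
Hypothesis x0 : x 0 = 1.

Local Notation store := (store_at lt (configuration l x)).

Lemma run_trace n :
  (forall j, j < n -> w j \in es /\ lt j = edge_letter (w j)) ->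
  (forall j, j < n -> passes (grd (lt j)) (store j)) ->
  exists l' x', [/\ trace (mkseq w n) l x l' x', x' 0 = 1 &
    store n = configuration l' x'].
Proof.
elim: n => [_ _|n IHn hw hpass]; first by exists l, x.
have [||l1 [x1 [tr x10 st]]] := IHn; first by move=> j ltj; apply: hw; lia.
  by move=> j ltj; apply: hpass; lia.
have [wn ltn] := hw n (ltnSn n).
have := hpass n (ltnSn n).
have -> : store n.+1 = fun r => value (upd (lt n) r) (store n) by [].
rewrite mkseqS st ltn.
have bo := allP es_bounded _ wn; have po := allP es_constant _ wn.
case: (w n) bo po => -[s o] t /= bo po.
move=> /(edge_letter_passes s t l1 bo x10) [ls en].
exists t, (update o x1); split.
- by apply/trace_rcons; exists x1; split; rewrite // -ls.
- by rewrite /update; case: eqP po => // <-.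
- exact: edge_letter_update.
Qed.

Lemma trace_run n l' x' :
  (forall j, j < n -> w j \in es /\ lt j = edge_letter (w j)) ->
  trace (mkseq w n) l x l' x' ->
  [/\ forall j, j < n -> passes (grd (lt j)) (store j), x' 0 = 1 &
    store n = configuration l' x'].
Proof.
elim: n l' x' => [|n IHn] l' x' hw; first by case=> <- <-.
have [wn ltn] := hw n (ltnSn n); rewrite mkseqS.
have bo := allP es_bounded _ wn; have po := allP es_constant _ wn.
case E : (w n) bo po => [[s o] t] /= bo po.
move/trace_rcons => [y [tr en -> ->]].
have [|hpass y0 st] := IHn _ _ _ tr; first by move=> j ltj; apply: hw; lia.
split.
- move=> j; rewrite ltnS leq_eqVlt => /orP[/eqP ->|]; last exact: hpass.
  by rewrite st ltn E; apply/edge_letter_passes.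
- by rewrite /update; case: eqP po => // <-.
- by rewrite /= st ltn E; exact: edge_letter_update.
Qed.

Lemma accepting_run n :
  (forall j, j < n -> w j \in es /\ lt j = edge_letter (w j)) ->
  ((forall j, j < n -> passes (grd (lt j)) (store j)) /\
    passes (halted halt out) (store n)) <->
  exists2 x', trace (mkseq w n) l x halt x' & x' out = 0.
Proof.
move=> hw; split=> [[hpass]|[x' tr xout]].
  have [l' [x' [tr x'0 ->]]] := run_trace hw hpass.
  by move/(halted_passes _ _ out_lt x'0) => [<-]; exists x'.
have [hpass x'0 st] := trace_run hw tr.
by split=> //; rewrite st; apply/halted_passes.
Qed.

End word.

End machine.

(** * The machine of a mu-recursive function *)

Section construction.
Variable H : murec.

(** The edges of [full_prog] after its two initial assignments, whence the labels. They are isolated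
    to avoid a circle: the number of states depends on the registers used, while the assignments
    contain the number of states. *)
Definition core_edges : seq edge := edges (compile H [:: 1; 2; 3] 4 5) 3 1 4.

Definition op_registers (o : op) : seq nat := tgt o :: lhs o ++ rhs o ++ src o.

Definition max_register : nat :=
  foldr maxn 4 (flatten [seq op_registers e.1.2 | e <- core_edges]).

Local Notation k := max_register.+1.
Local Notation d := max_register.

(* Loads into registers 2 and 3 the numbers which determine the dimensions of *)
(* the automaton; as constants they only show up in the matrix entries.       *)
Definition full_prog : prog :=
  Then (assign 2 (nseq (nothers d) 0))
    (Then (assign 3 (nseq (size core_edges).+4 0)) (compile H [:: 1; 2; 3] 4 5)).

Definition all_edges : seq edge := edges full_prog 0 1 2.

Definition machine_letters : seq letter := map (edge_letter k) all_edges.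

Definition halting_guards : guards := halted k 1 4.

Lemma max_register_ge : 4 <= max_register.
Proof.
by rewrite /max_register; elim: flatten => [|r s IHs] //=; rewrite leq_max IHs orbT.
Qed.

Lemma le_max_register e r : e \in core_edges -> r \in op_registers e.1.2 -> r < k.
Proof.
move=> e_in r_in; rewrite ltnS.
have : r \in flatten [seq op_registers e.1.2 | e <- core_edges].
  by apply/flattenP; exists (op_registers e.1.2) => //; exact: map_f.
rewrite /max_register; elim: flatten => [|r' s IHs] //=.
by rewrite in_cons leq_max => /orP[/eqP ->|/IHs ->]; rewrite ?leqnn ?orbT.
Qed.

Lemma all_edges_bounded : all (fun e => bounded_op k e.1.2) all_edges.
Proof.
have ge4 := max_register_ge.
have const n : bounded k (nseq n 0) by rewrite /bounded all_nseq orbT.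
apply/allP => e; rewrite !in_cons => /or3P[/eqP ->|/eqP ->|e_in].
- by rewrite /bounded_op /= const; lia.
- by rewrite /bounded_op /= const; lia.
have lt_reg := le_max_register e_in; apply/and4P; split.
- by apply/allP => r r_in; apply: lt_reg; rewrite /op_registers in_cons !mem_cat r_in orbT.
- by apply/allP => r r_in; apply: lt_reg; rewrite /op_registers in_cons !mem_cat r_in !orbT.
- by apply/allP => r r_in; apply: lt_reg; rewrite /op_registers in_cons !mem_cat r_in !orbT.
- by apply: lt_reg; rewrite mem_head.
Qed.

Lemma all_edges_constant : all (fun e : edge => 0 < tgt e.1.2) all_edges.
Proof.
by apply: edges_keep_constant; rewrite /= compile_keeps_constant.
Qed.

Lemma machine_letters_bounded : all (bounded_letter d.+2) machine_letters.
Proof.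
rewrite all_map; apply: sub_all all_edges_bounded => e be /=.
by apply: edge_letter_bounded be; have := max_register_ge; lia.
Qed.

Lemma halting_guards_bounded : bounded_guards d.+2 halting_guards.
Proof. by apply: halted_bounded; have := max_register_ge; lia. Qed.

Lemma size_machine_letters : (size machine_letters).+2 = (size core_edges).+4.
Proof. by rewrite size_map. Qed.

Lemma full_prog_eval c :
  (exists2 x', sem full_prog (init_store c) x' & x' 4 = 0) <->
  eval H [:: c; nothers d; (size core_edges).+4] 0.
Proof.
pose x1 r := if r == 2 then nothers d else init_store c r.
pose x2 r := if r == 3 then (size core_edges).+4 else x1 r.
have value_const n x : x 0 = 1 -> value (nseq n 0) x = n.
  by move=> x0; rewrite /value map_nseq sumn_nseq x0 mul1n.
have sem1 z : sem (assign 2 (nseq (nothers d) 0)) (init_store c) z <-> z = x1.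
  by rewrite sem_assign value_const.
have sem2 z : sem (assign 3 (nseq (size core_edges).+4 0)) x1 z <-> z = x2.
  by rewrite sem_assign value_const.
have [a123 lt4 x20] : [/\ all (fun r => r < 5) [:: 1; 2; 3], 0 < 4 < 5 & x2 0 = 1] by [].
split=> [[x' [z1 /sem1 -> [z2 /sem2 -> hsem]] x'4]|ev].
  by have [] := compile_sound a123 lt4 x20 hsem; rewrite x'4.
have [x' hsem x'4] := compile_complete a123 lt4 x20 ev.
exists x' => //; exists x1; first exact/sem1.
by exists x2 => //; exact/sem2.
Qed.

(** Coordinate [k] lies beyond 1, so it initially holds 0, the entry label of [full_prog]. *)
Lemma init_configuration c : init_store c = configuration k 0 (init_store c).
Proof.
apply/funext => r; rewrite /configuration; case: eqP => // ->.
by case: max_register max_register_ge.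
Qed.

Variables (R : realType) (c : nat).

Local Notation A := (encoded d machine_letters halting_guards c).

Variables (E : set (path_space A)) (b : bool).
Hypothesis mE : measurable E.
Hypothesis E_rej : forall x : path_space A,
  (exists n, decode (x n) = inr Rej) -> (forall n, decode (x n) != inr Acc) -> ~ E x.
Hypothesis E_acc : forall x : path_space A,
  (exists n, decode (x n) = inr Acc) -> (forall n, decode (x n) != inr Rej) -> E x.
Hypothesis E_never : forall x : path_space A,
  (forall n, decode (x n) != inr Acc) -> (forall n, decode (x n) != inr Rej) -> E x <-> b.

Lemma event_eval :
  (exists w, path_prob R A w E = (ratr (1 / 2)%R)%:E) <->
  eval H [:: c; nothers d; (size core_edges).+4] 0.
Proof.
have k2 : 1 < k by have := max_register_ge; lia.
have out_lt : 4 < k by have := max_register_ge; lia.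
have run lt w n := @accepting_run k k2 all_edges 1 4 all_edges_bounded
  all_edges_constant out_lt lt w 0 (init_store c) erefl n.
rewrite -init_configuration in run.
pose e0 : edge := (0, skip_op, 0).
have letterE (w : nat -> 'I_(size machine_letters).+2) n :
    (forall j, 0 < j <= n -> 2 <= w j) -> forall j, j < n ->
    nth e0 all_edges (w j.+1 - 2) \in all_edges /\
    run_letter w j = edge_letter k (nth e0 all_edges (w j.+1 - 2)).
  move=> wn j ltj; have lt_w : w j.+1 - 2 < size all_edges.
    have := wn j.+1 ltj; have := ltn_ord (w j.+1).
    have size_ls : size machine_letters = size all_edges by rewrite size_map.
    by move: (nat_of_ord _) => i; rewrite size_ls; lia.
  by split; [exact: mem_nth | rewrite /run_letter (nth_map e0)].
rewrite -full_prog_eval; split=> [[w]|[x' hsem x'4]].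
  move/(prob_event R _ mE E_rej E_acc E_never).
  case=> n [w0 wn w1] /(dist_stop machine_letters_bounded halting_guards_bounded _ w0 wn w1).
  move=> /(run _ _ _ (letterE w n wn)) [x' tr x'4].
  have sub : {subset mkseq (fun j => nth e0 all_edges (w j.+1 - 2)) n <= all_edges}.
    by move=> e /mapP[j]; rewrite mem_iota => /andP[_ ltj] ->; case: (letterE w n wn j).
  by exists x'; first exact: (@edges_sound full_prog 0 1 2 _ _ _ isT isT isT sub tr).
have [u su tr] := edges_complete 0 1 2 hsem.
(* The word of a run [u]: the start letter, the edges of [u] shifted by 2, then the stop letter for
   ever. *)
pose w j : 'I_(size machine_letters).+2 := inord
  (if j == 0 then 0 else if j <= size u then (index (nth e0 u j.-1) all_edges).+2 else 1).
have wE j : 0 < j <= size u -> w j = (index (nth e0 u j.-1) all_edges).+2 :> nat.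
  case/andP=> j0 ju; rewrite /w gtn_eqF // ju inordK //.
  have : index (nth e0 u j.-1) all_edges < size all_edges.
    by rewrite index_mem; apply: su; apply: mem_nth; lia.
  by rewrite size_map; lia.
have wu : mkseq (fun j => nth e0 all_edges (w j.+1 - 2)) (size u) = u.
  rewrite -[RHS](mkseq_nth e0); apply/eq_in_map => j; rewrite mem_iota => /andP[_ ltj].
  by rewrite wE // subn2 /= nth_index //; apply: su; exact: mem_nth.
have wn j : 0 < j <= size u -> 2 <= w j by move=> hj; rewrite wE.
exists w; apply/(prob_event R _ mE E_rej E_acc E_never).
have w0 : \val (w 0) = 0 by rewrite /= /w inordK.
have w1 : \val (w (size u).+1) = 1 by rewrite /= /w ltnn inordK.
exists (size u); split=> //.
apply/(dist_stop machine_letters_bounded halting_guards_bounded _ w0 wn w1).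
apply/(run _ _ _ (letterE w _ wn)).
by exists x'; rewrite // wu.
Qed.

End construction.

(** * The code of the instance *)

Section encoding.
Variables (d : nat) (ls : seq letter) (fin : guards).

Lemma rat_digits_frac (a m : nat) : 0 < m -> coprime a m ->
  rat_digits (a%:R / m%:R)%R = [:: a; m].
Proof.
move=> m0 cop; rewrite /rat_digits !pmulrn.
rewrite coprimeq_num ?coprimeq_den // gtr0_sg ?ltz_nat // mul1r.
by rewrite (_ : (Posz m == 0) = false) ?absz_id // eqz_nat gtn_eqF.
Qed.

(** For [b = true] everything except [Rej], for safety; for [b = false] only [Acc], for
    reachability. *)
Definition accepting_set (b : bool) : {set 'I_(nothers d).+4.+3} :=
  [set q | (decode q == inr Acc) || (b && (decode q != inr Rej))].

Lemma encoded_absorbing c :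
  acceptance_absorbing (encoded d ls fin c) (accepting_set false).
Proof.
move=> q; rewrite inE orbF => /eqP zq a.
by rewrite -[LHS]/(step ls fin c (val a) (decode q) (decode q)) zq step_absorbing ?eqxx.
Qed.

Lemma accepting_digits b :
  [seq nat_of_bool (q \in accepting_set b) | q <- enum 'I_(nothers d).+4.+3] =
  nseq 5 (nat_of_bool b) ++ [:: 1; 0] ++ nseq (nothers d) (nat_of_bool b).
Proof.
pose F (t : state d) := nat_of_bool ((t == inr Acc) || (b && (t != inr Rej))).
transitivity [seq F (decode q) | q <- enum 'I_(nothers d).+4.+3].
  by apply: eq_map => q; rewrite inE.
rewrite map_decode map_cat /F /= !andbT !andbF; do 7 congr (_ :: _).
rewrite /nothers; have : all [predC first_states d] (other_states d).
  by apply/allP => t; rewrite mem_filter => /andP[].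
elim: (other_states d) => [|t s IHs] //= /andP[neq /IHs ->]; congr (_ :: _).
by case: t neq => [u|[]] // _; rewrite andbT.
Qed.

Definition row_digits (c a : nat) (p : state d) (qs : seq (state d)) : seq nat :=
  flatten [seq rat_digits (step ls fin c a p q) | q <- qs].

Definition transition_digits (c : nat) : seq nat :=
  flatten [seq flatten [seq row_digits c a p (states d) | p <- states d]
          | a <- iota 0 (size ls).+2].

Lemma transition_digitsE c :
  flatten [seq flatten [seq flatten
         [seq rat_digits (trans (encoded d ls fin c) a p q)
         | q <- enum 'I_(nothers d).+4.+3]
         | p <- enum 'I_(nothers d).+4.+3]
         | a <- enum 'I_(size ls).+2] = transition_digits c.
Proof.
rewrite /transition_digits -val_enum_ord -map_comp; congr flatten.
apply: eq_map => a.
rewrite -[RHS]/(flatten [seq row_digits c (val a) p (states d) | p <- states d]).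
rewrite -(map_decode (fun p => row_digits c (val a) p (states d))); congr flatten.
apply: eq_map => p; rewrite /row_digits; congr flatten.
by rewrite -(map_decode (fun q => rat_digits (step ls fin c (val a) (decode p) q))).
Qed.

(* The part of the transition table which does not depend on the input c. *)
Definition common_digits : seq nat :=
  row_digits 0 0 (inr Init) (drop 5 (states d)) ++
  flatten [seq row_digits 0 0 p (states d) | p <- behead (states d)] ++
  flatten [seq flatten [seq row_digits 0 a p (states d) | p <- states d]
          | a <- iota 1 (size ls).+1].

Definition input_digits (c : nat) : seq nat :=
  let s := (1 + c) ^ 2 in [:: 0; 1; 1; s; c; s; c; s; c ^ 2; s].

(** Only the row of [Init] under the start letter involves [c], and its nonzero entries are at the
    four pairs of coordinates below 2. Their fractions are already reduced because [c] and [1 + c]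
    are coprime. *)
Lemma transition_digits_split c :
  transition_digits c = input_digits c ++ common_digits.
Proof.
have stepE a p q : (a, p) != (0, inr Init) -> step ls fin c a p q = step ls fin 0 a p q.
  by case: a => [|[|a]]; case: p => [u|[]].
have rowE a p qs : (a, p) != (0, inr Init) -> row_digits c a p qs = row_digits 0 a p qs.
  move=> neq; congr flatten; apply: eq_map => q; by rewrite stepE.
transitivity ((row_digits c 0 (inr Init) (states d) ++
    flatten [seq row_digits c 0 p (states d) | p <- behead (states d)]) ++
  flatten [seq flatten [seq row_digits c a p (states d) | p <- states d]
          | a <- iota 1 (size ls).+1]); first by [].
have -> : row_digits c 0 (inr Init) (states d) =
    input_digits c ++ row_digits 0 0 (inr Init) (drop 5 (states d)).
  have startE c' q : step ls fin c' 0 (inr Init) q = init_row c' q.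
    by rewrite step_start.
  rewrite /row_digits -{1}(cat_take_drop 5 (states d)) map_cat flatten_cat.
  congr (_ ++ _).
    have cop a : coprime a (1 + c) -> coprime a ((1 + c) ^ 2).
      by move=> ?; rewrite coprimeXr.
    have s0 : 0 < (1 + c) ^ 2 by rewrite expn_gt0.
    have copc : coprime c ((1 + c) ^ 2) by rewrite cop // add1n coprimenS.
    have digitsE (i j : 'I_d.+2) : i < 2 -> j < 2 ->
        rat_digits (init_row c (inl (i, j))) =
        [:: init_store c i * init_store c j; (1 + c) ^ 2].
      move=> lti ltj; apply: rat_digits_frac => //.
      have copr r : r < 2 -> coprime (init_store c r) ((1 + c) ^ 2).
        by case: r => [|[|r]] //= _; rewrite coprime1n.
      by rewrite coprimeMl !copr.
    rewrite [take _ _]/= [map _ _]/= !startE !digitsE //=.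
    by rewrite !mul1n !muln1 mulnn.
  congr flatten; apply/eq_in_map => q q_in; rewrite !startE.
  case: q q_in => [[i j]|m] //; rewrite /= !inE /= mem_filter => /andP[+ _].
  rewrite !inE !negb_or /init_row /=.
  case: i j => [[|[|i]] lti] [[|[|j]] ltj] //=; rewrite ?muln0 ?mul0r //.
have -> : [seq row_digits c 0 p (states d) | p <- behead (states d)] =
    [seq row_digits 0 0 p (states d) | p <- behead (states d)].
  apply/eq_in_map => p p_in; apply: rowE; apply: contraTN p_in => /eqP[->].
  by have := states_uniq d => /= /andP[].
have -> : [seq flatten [seq row_digits c a p (states d) | p <- states d]
          | a <- iota 1 (size ls).+1] =
    [seq flatten [seq row_digits 0 a p (states d) | p <- states d]
          | a <- iota 1 (size ls).+1].
  apply/eq_in_map => a; rewrite mem_iota => /andP[a0 _]; congr flatten.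
  by apply/eq_map => p; apply: rowE; case: a a0.
by rewrite /common_digits -!catA.
Qed.

Lemma half_itv : (0 < (1 / 2 : rat) < 1)%R. Proof. by []. Qed.

Definition encoded_instance (b : bool) (c : nat) : instance :=
  @Instance _ _ (encoded d ls fin c) (accepting_set b) (1 / 2)%R half_itv.

(** The effect on [CodeSeq.code] of adding [a] at the head of a list. *)
Definition cons_code (a m : nat) : nat := 2 ^ a * m.*2.+1.

Lemma code_cat s1 s2 :
  CodeSeq.code (s1 ++ s2) = foldr cons_code (CodeSeq.code s2) s1.
Proof. by rewrite /CodeSeq.code foldr_cat. Qed.

Lemma instance_code_encoded b c :
  instance_code (encoded_instance b c) =
  foldr cons_code (iter (nothers d) (cons_code b)
     (foldr cons_code (CodeSeq.code common_digits) (input_digits c)))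
   ([:: (nothers d).+4.+3; (size ls).+2; 0; 1; 2] ++ nseq 5 (nat_of_bool b) ++ [:: 1; 0]).
Proof.
rewrite /instance_code [automaton _]/= transition_digitsE [accepting _]/=.
rewrite accepting_digits transition_digits_split.
rewrite [threshold _]/= -[(1 / 2)%R]/(1%:R / 2%:R)%R rat_digits_frac //.
rewrite -[nstates _]/(nothers d).+4.+3 -[nletters _]/(size ls).+2 [val _]/=.
have foldr_nseq n m : foldr cons_code m (nseq n (nat_of_bool b)) =
    iter n (cons_code b) m by elim: n => //= n ->.
by move: common_digits => s; rewrite !code_cat !foldr_cat !foldr_nseq.
Qed.

End encoding.

(** * Diagonalisation *)

Lemma eval_comp1 f g xs a y :
  eval g xs a -> eval f [:: a] y -> eval (Comp f [:: g]) xs y.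
Proof. by move=> eg ef; apply: (@eval_comp _ _ _ [:: a]) => // -[]. Qed.

Lemma eval_comp2 f g h xs a b y :
  eval g xs a -> eval h xs b -> eval f [:: a; b] y -> eval (Comp f [:: g; h]) xs y.
Proof. by move=> eg eh ef; apply: (@eval_comp _ _ _ [:: a; b]) => // -[|[]]. Qed.

(** * Mu-recursive terms for the coding of lists *)

Definition add_term : murec := PrimRec (Proj 0) (Comp Succ [:: Proj 1]).

Lemma eval_add m n : eval add_term [:: m; n] (m + n).
Proof.
elim: m => [|m IHm]; first by apply: eval_rec0; exact: (eval_proj (xs := [:: n])).
apply: eval_recS IHm _; apply: eval_comp1 (eval_succ _ _).
exact: (eval_proj (i := 1)).
Qed.

Definition mul_term : murec := PrimRec Zero (Comp add_term [:: Proj 1; Proj 2]).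

Lemma eval_mul m n : eval mul_term [:: m; n] (m * n).
Proof.
elim: m => [|m IHm]; first by apply: eval_rec0; exact: eval_zero.
apply: eval_recS IHm _; rewrite mulSn addnC.
by apply: eval_comp2 (eval_add _ _); exact: (eval_proj (xs := [:: m; m * n; n])).
Qed.

Definition double_term (t : murec) : murec := Comp add_term [:: t; t].

Lemma eval_double t xs m : eval t xs m -> eval (double_term t) xs m.*2.
Proof. by move=> et; rewrite -addnn; apply: eval_comp2 (eval_add _ _). Qed.

Definition cons_term : murec :=
  PrimRec (Comp Succ [:: double_term (Proj 0)]) (double_term (Proj 1)).

Lemma eval_cons a m : eval cons_term [:: a; m] (cons_code a m).
Proof.
elim: a => [|a IHa].
  rewrite /cons_code mul1n; apply: eval_rec0.
  apply: eval_comp1 (eval_succ _ _); apply: eval_double.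
  exact: (eval_proj (xs := [:: m])).
apply: eval_recS IHa _; rewrite {2}/cons_code expnS -mulnA mul2n.
by apply: eval_double; exact: (eval_proj (xs := [:: a; cons_code a m; m])).
Qed.

Fixpoint const_term (n : nat) : murec :=
  if n is n'.+1 then Comp Succ [:: const_term n'] else Zero.

Lemma eval_const n xs : eval (const_term n) xs n.
Proof.
elim: n => [|n IHn]; first exact: eval_zero.
exact: eval_comp1 IHn (eval_succ _ _).
Qed.

Definition iter_cons_term (b : nat) : murec :=
  PrimRec (Proj 0) (Comp cons_term [:: const_term b; Proj 1]).

Lemma eval_iter_cons b n m :
  eval (iter_cons_term b) [:: n; m] (iter n (cons_code b) m).
Proof.
elim: n => [|n IHn]; first by apply: eval_rec0; exact: (eval_proj (xs := [:: m])).
apply: eval_recS IHn _; apply: eval_comp2 (eval_const _ _) _ (eval_cons _ _).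
exact: (eval_proj (i := 1)).
Qed.

Definition prepend_term (ts : seq murec) (t : murec) : murec :=
  foldr (fun u v => Comp cons_term [:: u; v]) t ts.

Lemma eval_prepend ts t xs vs m : size ts = size vs ->
  (forall i, i < size ts -> eval (nth Zero ts i) xs (nth 0 vs i)) ->
  eval t xs m -> eval (prepend_term ts t) xs (foldr cons_code m vs).
Proof.
elim: ts vs => [|u ts IHts] [|v vs] //= [sz] ev et.
apply: eval_comp2 (ev 0 isT) _ (eval_cons _ _).
by apply: IHts => // i; exact: (ev i.+1).
Qed.

(* On arguments c, N and L this computes the code of the instance with input  *)
(* c, N + 7 states and L letters.                                             *)
Definition code_term (b : bool) : murec :=
  let s := Comp mul_term [:: Comp Succ [:: Proj 0]; Comp Succ [:: Proj 0]] in
  prepend_term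
    ([:: Comp add_term [:: Proj 1; const_term 7]; Proj 2; Zero; const_term 1;
         const_term 2] ++ nseq 5 (const_term b) ++ [:: const_term 1; Zero])
    (Comp (iter_cons_term b) [:: Proj 1;
       prepend_term [:: Zero; const_term 1; const_term 1; s; Proj 0; s; Proj 0; s;
                        Comp mul_term [:: Proj 0; Proj 0]; s] (Proj 0)]).

(** * The self-referential instance *)

Section diagonal.
Variables (f : murec) (b : bool).

Definition diagonal_term : murec := Comp f [:: code_term b].

Local Notation d := (max_register diagonal_term).
Local Notation ls := (machine_letters diagonal_term).
Local Notation fin := (halting_guards diagonal_term).

(* The input c of the automaton encodes the rest of its own description.      *)
Definition diagonal_input : nat := CodeSeq.code (common_digits d ls fin).

Definition diagonal_instance : instance :=
  encoded_instance d ls fin b diagonal_input.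

(** The input plays two roles: it is the code of the common digits, onto which the explicit digits
    are consed, and it is the [c] from which the input digits are computed. *)
Lemma eval_code_term :
  eval (code_term b)
    [:: diagonal_input; nothers d; (size (core_edges diagonal_term)).+4]
    (instance_code diagonal_instance).
Proof.
rewrite instance_code_encoded -/diagonal_input size_machine_letters.
set xs := [:: _; _; _].
have p0 : eval (Proj 0) xs diagonal_input by exact: (eval_proj (xs := xs)).
have p1 : eval (Proj 1) xs (nothers d) by exact: (eval_proj (xs := xs)).
have p2 : eval (Proj 2) xs (size (core_edges diagonal_term)).+4.
  exact: (eval_proj (xs := xs)).
have es : eval (Comp mul_term [:: Comp Succ [:: Proj 0]; Comp Succ [:: Proj 0]]) xs
    ((1 + diagonal_input) ^ 2).
  by rewrite -mulnn; apply: eval_comp2 (eval_mul _ _); apply: eval_comp1 p0 (eval_succ _ _).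
have ec2 : eval (Comp mul_term [:: Proj 0; Proj 0]) xs (diagonal_input ^ 2).
  by rewrite -mulnn; exact: (eval_comp2 p0 p0 (eval_mul _ _)).
have eN : eval (Comp add_term [:: Proj 1; const_term 7]) xs (nothers d).+4.+3.
  rewrite -[(nothers d).+4.+3]/(7 + nothers d) [7 + _]addnC.
  by apply: eval_comp2 p1 (eval_const _ _) (eval_add _ _).
apply: eval_prepend => //.
  case=> [_|]; first exact: eN.
  case=> [_|]; first exact: p2.
  case=> [_|]; first exact: eval_zero.
  do 8 (case=> [_|]; first exact: eval_const).
  case=> [_|//]; exact: eval_zero.
apply: eval_comp2 p1 _ (eval_iter_cons _ _ _).
apply: eval_prepend => //.
case=> [_|]; first exact: eval_zero.
do 2 (case=> [_|]; first exact: eval_const).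
do 2 (case=> [_|]; [exact: es | case=> [_|]; first exact: p0]).
case=> [_|]; first exact: es.
case=> [_|]; first exact: ec2.
case=> [_|]; first exact: es.
by [].
Qed.

Lemma diagonal_eval :
  eval f [:: instance_code diagonal_instance] 0 <->
  eval diagonal_term
    [:: diagonal_input; nothers d; (size (core_edges diagonal_term)).+4] 0.
Proof.
split=> [ev|ev]; first exact: eval_comp1 eval_code_term ev.
inversion ev as [| | |f0 gs0 xs0 ys y0 sz evgs evf| | |]; subst.
case: ys sz evgs evf => [|v []] // _ evgs evf.
by rewrite (eval_inj eval_code_term (evgs 0 isT)).
Qed.

End diagonal.

(** * Contradiction with a decider *)

Section equality.
Variables (R : realType) (f : murec).

Lemma diagonal_safety :
  safety_equality R (diagonal_instance f true) <->
  eval f [:: instance_code (diagonal_instance f true)] 0.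
Proof.
rewrite diagonal_eval; apply: (@event_eval _ R _ _ true).
- exact: measurable_safe.
- by move=> x [n zn] _ /(_ n); rewrite inE zn.
- by move=> x _ never n; rewrite inE never orbT.
- by move=> x _ never; split=> // _ n; rewrite inE never orbT.
Qed.

Lemma diagonal_reachability :
  reachability_equality R (diagonal_instance f false) <->
  eval f [:: instance_code (diagonal_instance f false)] 0.
Proof.
rewrite diagonal_eval; apply: (@event_eval _ R _ _ false).
- exact: measurable_reach.
- by move=> x _ never [n]; rewrite inE orbF (negbTE (never n)).
- by move=> x [n zn] _; exists n; rewrite inE zn.
- by move=> x never _; split=> // -[n]; rewrite inE orbF (negbTE (never n)).
Qed.

Lemma diagonal_absorbing :
  acceptance_absorbing (automaton (diagonal_instance f false))
    (accepting (diagonal_instance f false)).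
Proof. exact: encoded_absorbing. Qed.

End equality.

(** On [X f] the answer 1 would entail the value 0, against determinism of [eval], and the answer 0
    would make the property true. *)
Lemma undecidable_of_diagonal (D P : instance -> Prop) (X : murec -> instance) :
  (forall f, D (X f)) -> (forall f, P (X f) <-> eval f [:: instance_code (X f)] 0) ->
  ~ decidable_on instance_code D P.
Proof.
move=> DX PX [f decides]; have [b [ev bP]] := decides _ (DX f).
case: b ev bP => ev bP.
  by have /PX ev0 := proj1 bP isT; have := eval_inj ev ev0.
by have /PX/(proj2 bP) := ev.
Qed.

Theorem theorem1 (R : realType) :
  ~ decidable_on instance_code (fun X : instance => True)
      (fun X : instance => safety_equality R X) /\
  ~ decidable_on instance_code
      (fun X : instance => acceptance_absorbing (automaton X) (accepting X))
      (fun X : instance => reachability_equality R X).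
Proof.
split.
- by apply: (undecidable_of_diagonal (X := fun f => diagonal_instance f true)) => // f;
    exact: diagonal_safety.
- apply: (undecidable_of_diagonal (X := fun f => diagonal_instance f false)) => f.
    exact: diagonal_absorbing.
  exact: diagonal_reachability.
Qed.
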